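(* For any $z,z_0\in\Sigma$, $$E^{\mathbb{Q}}_{z_0}\big[(G_{T_\Delta}(z))^2\big]\le4\,E^{\mathbb{Q}}_{z_0}\big[G_{T_\Delta}(z)\big]\ \sup_{z_0'\in\Sigma}E^{\mathbb{Q}}_{z_0'}\big[G_{T_\Delta}(z)\big].$$ The result is also true with $T_\Delta$ replaced by a deterministic time.
   Context: $\Sigma$ is a locally compact Polish metric space with Borel $\sigma$-algebra, $\mu$ a Radon measure, and $g:\Sigma\times\Sigma\to\mathbb{R}_+$ is measurable in each coordinate with $\int g(z,z')\mu(dz')=1$ for all $z$ (the transition density of a Markov chain). $\Sigma$ contains a cemetery state $\Delta$: $\mu(\{\Delta\})=1$ and $g(\Delta,\cdot)=1_{\{\Delta\}}(\cdot)$. Soft local time: under $\mathbb{Q}_{z_0}$ (expectation $E^{\mathbb{Q}}_{z_0}$), $\eta=\sum_{\lambda\in\Lambda}\delta_{(z_\lambda,v_\lambda)}$ is a Poisson point process on $\Sigma\times\mathbb{R}_+$ with intensity $\mu\otimes dv$, and, with $G_0\equiv0$ and the given initial point $z_0$, one defines iteratively for $n\ge1$ (almost surely): $\xi_n=\inf\{t\ge0:\exists(z_\lambda,v_\lambda)\notin\{(z_k,v_k)\}_{k=1}^{n-1}\text{ with }G_{n-1}(z_\lambda)+t\,g(z_{n-1},z_\lambda)\ge v_\lambda\}$; $G_n(z)=G_{n-1}(z)+\xi_n g(z_{n-1},z)$; $(z_n,v_n)$ is the unique pair $(z_\lambda,v_\lambda)\notin\{(z_k,v_k)\}_{k=1}^{n-1}$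 with $G_n(z_\lambda)=v_\lambda$. So $(z_n)_{n\ge1}$ is a Markov chain with transition density $g$ and $z_1$ has density $g(z_0,\cdot)$ with respect to $\mu$. $T_\Delta$ is the hitting time of $\Delta$ by $(z_n)_{n\ge1}$.
   Formalization: The density g is assumed jointly measurable on Σ×Σ rather than only measurable in each coordinate; with separate measurability alone the transition kernel and the variables z_n, G_n need not be measurable, so the expectations may be undefined. *)

(* Defs.v *)
From HB Require Import structures.
From mathcomp Require Import all_boot all_order all_algebra.
From mathcomp Require Import all_classical all_reals all_analysis.
From mathcomp Require Import measurable_realfun.

Set Implicit Arguments.
Unset Strict Implicit.
Unset Printing Implicit Defensive.

Import Order.TTheory GRing.Theory Num.Theory.
Import numFieldNormedType.Exports.

Local Open Scope classical_set_scope.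
Local Open Scope ring_scope.

(* The two structures are unrelated here; that the sigma-algebra is the Borel
   one is the predicate [borel_sigma_algebra] below. *)
#[short(type="measurableCompleteMetricType")]
HB.structure Definition MeasurableCompleteMetric (d : measure_display)
    (R : numDomainType) :=
  {T of Metric R T & Complete T & Measurable d T}.

Definition borel_sigma_algebra (d : measure_display) (R : realType)
    (S : measurableCompleteMetricType d R) : Prop :=
  @measurable d S = <<s [set U : set S | open U] >>.

Definition separable (T : topologicalType) : Prop :=
  exists2 D : set T, countable D & dense D.

(* Finiteness on compact sets is the usual local finiteness, since this is
   only used on locally compact spaces. *)
Definition radon (d : measure_display) (R : realType)
    (S : measurableCompleteMetricType d R)
    (mu : {measure set S -> \bar R}) : Prop :=
  (forall K : set S, compact K -> (mu K < +oo)%E) /\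
  (forall A : set S, measurable A ->
     mu A = ereal_sup [set mu K | K in [set K | compact K /\ K `<=` A]]).

Section point_processes.
Variables (d : measure_display) (R : realType).
Variable S : measurableCompleteMetricType d R.

(* A locally finite sum of Dirac masses on S x R_+, with countable index set
   L and possible multiplicities. *)
Definition point_measure
    (m : {measure set (S * measurableTypeR R) -> \bar R}) : Prop :=
  (exists (L : set nat) (p : nat -> S * measurableTypeR R),
     (forall i, L i -> 0 <= (p i).2) /\
     (forall A, measurable A -> m A = \esum_(i in L) \d_(p i) A)) /\
  (forall K : set (S * R), compact K -> (m K < +oo)%E).

Definition atoms (m : {measure set (S * measurableTypeR R) -> \bar R}) :
  set (S * R) := [set p | (0 < m [set p])%E].

Definition intensity (mu : {measure set S -> \bar R})
    (A : set (S * measurableTypeR R)) : \bar R :=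
  (mu \x @lebesgue_measure R)%E (A `&` [set p | 0 <= p.2]).

(* [eta w A] takes values in {0, 1, ..., +oo}.  The Poisson weights are
   written out because the library's [poisson_pmf] is constantly 1 at rate 0. *)
Definition poisson_point_process (mu : {measure set S -> \bar R})
    (dO : measure_display) (Omega : measurableType dO) (Q : probability Omega R)
    (eta : Omega -> {measure set (S * measurableTypeR R) -> \bar R}) : Prop :=
  [/\ forall w, point_measure (eta w),
      forall A, measurable A -> measurable_fun [set: Omega] (fun w => eta w A : \bar R),
      forall A, measurable A -> (intensity mu A < +oo)%E ->
        let r := fine (intensity mu A) in
        forall k : nat, Q [set w | eta w A = k%:R%:E] =
                        (r ^+ k / k`!%:R * expR (- r))%:E,
      forall A, measurable A -> intensity mu A = +oo%E ->
        Q [set w | eta w A = +oo%E] = 1%E &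
      forall (n : nat) (A : 'I_n -> set (S * measurableTypeR R))
             (B : 'I_n -> set (\bar R)),
        (forall i, measurable (A i)) -> trivIset setT A ->
        (forall i, measurable (B i)) ->
        Q (\bigcap_(i in [set: 'I_n]) [set w | B i (eta w (A i))]) =
        (\prod_(i < n) Q [set w | B i (eta w (A i))])%E].

End point_processes.

Section soft_local_times.
Variables (d : measure_display) (R : realType).
Variable S : measurableCompleteMetricType d R.
Variable g : S -> S -> R.

(* After n steps: G_n, {(z_k, v_k)}_{k = 1..n}, and z_n. *)
Record slt_state := SltState {
  slt_G : S -> R;
  slt_used : set (S * R);
  slt_z : S }.

(* [P] is the set of points (z_lambda, v_lambda).  The construction is only
   meaningful almost surely: [inf] is 0 on the empty set, and [get] returns
   some admissible point (or a default one) when it is not unique (or there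
   is none). *)
Definition slt_step (P : set (S * R)) (s : slt_state) : slt_state :=
  let xi := inf [set t : R | 0 <= t /\
    exists p, [/\ P p, ~ slt_used s p &
      slt_G s p.1 + t * g (slt_z s) p.1 >= p.2]] in
  let G := fun y => slt_G s y + xi * g (slt_z s) y in
  let p := get [set p | [/\ P p, ~ slt_used s p & G p.1 = p.2]] in
  SltState G (p |` slt_used s) p.1.

Definition slt_iter (P : set (S * R)) (z0 : S) (n : nat) : slt_state :=
  iter n (slt_step P) (SltState (fun=> 0) set0 z0).

Definition soft_local_time (P : set (S * R)) (z0 : S) (n : nat) : S -> R :=
  slt_G (slt_iter P z0 n).

Definition slt_chain (P : set (S * R)) (z0 : S) (n : nat) : S :=
  slt_z (slt_iter P z0 n).

End soft_local_times.

(* First time n >= 1 at which x hits a; [None] stands for +oo. *)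
Definition hitting_time (T : Type) (x : nat -> T) (a : T) : option nat :=
  if pselect (exists n, `[< (0 < n)%N /\ x n = a >]) is left h
  then Some (ex_minn h) else None.

Definition value_at (R : realType) (u : nat -> R) (t : option nat) : \bar R :=
  if t is Some n then (u n)%:E else limn (fun n => (u n)%:E).

(* G_{T_Delta}(z), with chain started at z0. *)
Definition slt_at_hitting (d : measure_display) (R : realType)
    (S : measurableCompleteMetricType d R) (g : S -> S -> R) (Delta : S)
    (P : set (S * R)) (z0 z : S) : \bar R :=
  value_at (fun n => soft_local_time g P z0 n z)
           (hitting_time (slt_chain g P z0) Delta).

(* Main.v *)
Require Import Defs.
From HB Require Import structures.
From mathcomp Require Import all_boot all_order all_algebra.
From mathcomp Require Import all_classical all_reals all_analysis.
From mathcomp Require Import measurable_realfun.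
From mathcomp Require Import ring lra.

Set Implicit Arguments.
Unset Strict Implicit.
Unset Printing Implicit Defensive.

Import Order.TTheory GRing.Theory Num.Theory.
Import numFieldNormedType.Exports.

Local Open Scope classical_set_scope.
Local Open Scope ring_scope.

(** Fix the point y0 at which the local time is read, write [a] for the value
    G(y0) reached so far and [x] for the current position of the chain.  The
    next increment of G is a standard exponential variable times g(x,.), and
    the next position has density g(x,.) and is independent of that variable.
    Hence, when G starts from 0, the first two moments m_n(x) and s_n(x) of
    G_n(y0) satisfy
      m_(n+1) = g(.,y0) + K m_n,
      s_(n+1) = 2 g(.,y0)^2 + 2 g(.,y0) K m_n + K s_n,
    where K f(x) is the integral of g(x,y) f(y) mu(dy), restricted to y <> Delta
    when the chain is stopped at Delta.  If M bounds all the m_n, then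
      s_(n+1) = 2 g(.,y0) m_(n+1) + K s_n <= 2 M g(.,y0) + 2 M K m_n
              = 2 M m_(n+1)
    by induction ([second_le]); this is the inequality, with the constant 2.
    The hitting time follows by monotone convergence, because the local time
    at Delta is the increasing limit of the local times stopped at Delta.

    The recursion for the moments has to be extracted from the Poisson process,
    without a Markov property at the random levels xi_n.  For a configuration m
    of points and a state s of the construction, [chain_sum n s m] is the sum,
    over all n-tuples (p_1, ..., p_n) of points of m that could be the next n
    points of the construction, of h(G_n(y0)), restricted to the tuples for
    which no other point of m lies under the final graph G_n.  This
    functional links both sides:
    - Its expectation is computed by applying Mecke's formula ([mecke]) once
      for each point of the tuple.  The point under the integral then ranges
      over mu times the Lebesgue measure, and adding it to the configuration is
      harmless because a used height is disregarded afterwards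
      ([chain_sum_add_point]).  At the end the void probability contributes
      exp(- integral of G_n), and the integral over the height v of the new
      point is an elementary integral of a quadratic polynomial against
      exp(-t), with t = xi.  For quadratic h this gives
      [expectation_chain_sum], where the recursions above appear.
    - For a given m, at most one tuple contributes, namely the one selected by
      the infimum in the construction; when it does, the value is h(G_n(y0))
      ([chain_sumE]).
    With h = 1 the functional takes only the values 0 and 1 and has mean 1, so
    the construction is almost surely well defined
    ([almost_surely_valid]).  With h(a) = |a| and h(a) = a^2, both nonnegative
    everywhere, one obtains the two moments.

    The local time itself is defined by an infimum and a choice, so it
    is only known to agree almost surely with a measurable functional.  This is
    enough: the integral of a nonnegative function is defined for
    arbitrary integrands, and depends only on the class of the integrand modulo
    null sets ([ge0_integral_eq_ae], [monotone_convergence_ae]). *)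

(** * Locally finite point configurations *)

Record exhaustion (d : measure_display) (X : measurableType d) := Exhaustion {
  exh_set :> nat -> set X;
  exh_measurable : forall j, measurable (exh_set j);
  exh_nd : nondecreasing_seq exh_set;
  exh_cover : \bigcup_j exh_set j = setT }.

Section configurations.
Context (d : measure_display) (X : measurableType d) (R : realType).
Variable Y : exhaustion X.

Definition bounded_in (A : set X) := exists j, A `<=` Y j.

(** Point configurations are measures with natural values on bounded measurable
    sets. This is all that the decomposition of events by counts uses, and it is
    preserved when a Dirac mass is added. *)
Record config := Config {
  config_measure :> {measure set X -> \bar R};
  config_nat : forall A, measurable A -> bounded_in A ->
    exists k : nat, config_measure A = k%:R%:E }.

Lemma mzero_config_nat A : measurable A -> bounded_in A ->
  exists k : nat, @mzero d X R A = k%:R%:E.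
Proof. by move=> _ _; exists 0%N. Qed.

HB.instance Definition _ := gen_eqMixin config.
HB.instance Definition _ := gen_choiceMixin config.
HB.instance Definition _ := isPointed.Build config (Config mzero_config_nat).

Definition config_events : set (set config) :=
  [set [set m : config | C (m A)] | A in [set A | measurable A /\ bounded_in A]
                                  & C in measurable].

Definition config_display : measure_display. Proof. by constructor. Qed.

HB.instance Definition _ := @isMeasurable.Build config_display config
  <<s config_events >> (@sigma_algebra0 _ setT _) (@sigma_algebraC _ _)
  (@sigma_algebra_bigcup _ setT _).

Lemma bounded_exh j : bounded_in (Y j).
Proof. by exists j. Qed.

Lemma bounded_sub A B : A `<=` B -> bounded_in B -> bounded_in A.
Proof. by move=> AB [j Bj]; exists j; exact: subset_trans Bj. Qed.

Lemma config_fin_num (m : config) A :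
  measurable A -> bounded_in A -> m A \is a fin_num.
Proof. by move=> mA bA; have [k ->] := config_nat m mA bA. Qed.

Lemma measurable_to_config d' (T : measurableType d') (f : T -> config) :
  (forall A, measurable A -> bounded_in A ->
     measurable_fun [set: T] (fun t => f t A)) ->
  measurable_fun [set: T] f.
Proof.
move=> mf; apply: (measurability config_events) => // _ [_ [A [mA bA] [C mC <-]] <-].
by apply: (mf A mA bA).
Qed.

Lemma measurable_config_bounded A : measurable A -> bounded_in A ->
  measurable_fun [set: config] (fun m => m A : \bar R).
Proof.
move=> mA bA _ C mC; rewrite setTI; apply: sub_sigma_algebra.
by exists A => //; exists C.
Qed.

Lemma cvg_exhaustion (m : {measure set X -> \bar R}) A : measurable A ->
  m (A `&` Y j) @[j --> \oo] --> m A.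
Proof.
move=> mA.
have {2}-> : A = \bigcup_j (A `&` Y j) by rewrite -setI_bigcupr exh_cover setIT.
apply: nondecreasing_cvg_mu.
- by move=> j; apply: measurableI => //; exact: exh_measurable.
- by apply: bigcupT_measurable => j; apply: measurableI => //; exact: exh_measurable.
- by move=> i j ij; apply/subsetPset; apply: setIS; apply/subsetPset; exact: exh_nd.
Qed.

(** A general measurable set is the increasing union of its bounded traces, so
    its count is a limit of generating evaluations. *)
Lemma measurable_config_eval A : measurable A ->
  measurable_fun [set: config] (fun m => m A : \bar R).
Proof.
move=> mA; apply: (emeasurable_fun_cvg (fun j (m : config) => m (A `&` Y j))).
  move=> j; apply: measurable_config_bounded.
    by apply: measurableI => //; exact: exh_measurable.
  by apply: bounded_sub (bounded_exh j); exact: subIsetr.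
by move=> m _; exact: cvg_exhaustion.
Qed.

Import HBNNSimple.

Section sections.
Context (d' : measure_display) (T : measurableType d') (N : T -> config).
Hypothesis mN : measurable_fun [set: T] N.

Lemma measurable_eval A : measurable A ->
  measurable_fun [set: T] (fun t => N t A : \bar R).
Proof.
by move=> mA; apply: (measurableT_comp (measurable_config_eval mA) mN).
Qed.

Definition config_fam (t : T) : {measure set X -> \bar R} := N t.

HB.instance Definition _ := isKernel.Build _ _ T X R config_fam measurable_eval.

(** Seen as a function of [t], a measurable family of configurations is a
    kernel, and it is finite on each set of the exhaustion; the monotone class
    argument for finite kernels applies there, and the exhaustion gives the
    general case. *)
Lemma measurable_xsection_config (A : set (T * X)) : measurable A ->
  measurable_fun [set: T] (fun t => N t (xsection A t) : \bar R).
Proof.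
move=> mA.
apply: (emeasurable_fun_cvg (fun j t => N t (xsection A t `&` Y j))); last first.
  by move=> t _; apply: cvg_exhaustion; exact: measurable_xsection.
move=> j.
have [] // := @measurable_prod_subset_xsection_kernel _ _ T X R
  config_fam (Y j) (exh_measurable Y j) _ A mA.
move=> t; exists (fine (N t (Y j)) + 1) => B mB; rewrite /mrestr.
apply: (@le_lt_trans _ _ (N t (Y j))).
  apply: le_measure; rewrite ?inE.
  - by apply: measurableI => //; exact: exh_measurable.
  - exact: exh_measurable.
  - exact: subIsetr.
have := config_fin_num (N t) (exh_measurable Y j) (bounded_exh j).
by move=> /fineK {1}<-; rewrite lte_fin ltrDl.
Qed.

Lemma measurable_integral_config (F : T * X -> \bar R) :
  (forall z, 0 <= F z)%E -> measurable_fun [set: T * X] F ->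
  measurable_fun [set: T] (fun t => \int[N t]_x F (t, x))%E.
Proof.
move=> F0 mF.
apply: (measurable_fun_xsection_integral F config_fam (nnsfun_approx measurableT mF)).
- by move=> a b ab; exact: nd_nnsfun_approx.
- by move=> z; apply: cvg_nnsfun_approx.
- by move=> n r; exact: measurable_xsection_config.
Qed.

End sections.

End configurations.

(** * Mixtures of measures *)

Section mixture.
Import HBNNSimple.
Local Open Scope ereal_scope.
Context (dT dX dU : measure_display) (T : measurableType dT)
  (X : measurableType dX) (U : measurableType dU) (R : realType).
Variables (l : {measure set T -> \bar R}) (k : T -> {measure set X -> \bar R}).
Variable h : T * X -> U.
Definition measurable_sections := forall A : set (T * X), measurable A ->
  measurable_fun [set: T] (fun t => k t (xsection A t)).

(** The image, under (t, x) |-> h(t, x), of the measure l(dt) k_t(dx).  Both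
    sides of Mecke's formula are integrals against such a measure, once with k_t
    the configuration itself and once with k_t the constant intensity. *)
Definition mixture of measurable_sections & measurable_fun [set: T * X] h :=
  fun W : set U => \int[l]_t k t (xsection (h @^-1` W) t).

Hypothesis mk : measurable_sections.
Hypothesis mh : measurable_fun [set: T * X] h.
Local Notation mix := (mixture mk mh).

Let mpre W : measurable W -> measurable (h @^-1` W).
Proof. by move=> mW; rewrite -[X in measurable X]setTI; exact: mh. Qed.

Let mmix W : measurable W ->
  measurable_fun [set: T] (fun t => k t (xsection (h @^-1` W) t)).
Proof. by move=> mW; apply: mk; exact: mpre. Qed.

Let mixture0 : mix set0 = 0.
Proof.
by rewrite /mixture preimage_set0 integral0_eq// => t _; rewrite xsection0 measure0.
Qed.

Let mixture_ge0 W : 0 <= mix W.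
Proof. exact: integral_ge0. Qed.

Let mixture_sigma_additive : semi_sigma_additive mix.
Proof.
move=> F mF tF mUF; rewrite [X in _ --> X](_ : _ =
    \int[l]_t (\sum_(0 <= i <oo) k t (xsection (h @^-1` F i) t))); last first.
  apply: eq_integral => t _; rewrite preimage_bigcup xsection_bigcup.
  rewrite measure_bigcup//=; last 2 first.
  - by move=> i _; apply: measurable_xsection; exact: mpre.
  - apply/trivIsetP => i j _ _ ij; rewrite -subset0 => x [].
    move=> /xsectionP Fi /xsectionP Fj.
    have : (F i `&` F j) (h (t, x)) by [].
    by move/trivIsetP : tF => ->.
  by apply: eq_eseriesl => i; rewrite in_setT.
rewrite [X in X @ _](_ : _ = (fun n =>
    \int[l]_t (\sum_(0 <= i < n) k t (xsection (h @^-1` F i) t)))); last first.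
  by apply/funext => n; rewrite -ge0_integral_sum// => i; exact: mmix.
apply: cvg_monotone_convergence => //.
- by move=> n; apply: emeasurable_sum => i; exact: mmix.
- by move=> n x _; rewrite sume_ge0.
- by move=> x _ m n mn; exact: ereal_nondecreasing_series.
Qed.

HB.instance Definition _ := isMeasure.Build _ _ _ mix
  mixture0 mixture_ge0 mixture_sigma_additive.

Let section_nnsfun (phi : {nnsfun U >-> R}) t :
  \int[k t]_x (phi (h (t, x)))%:E =
  \sum_(r \in range phi) r%:E * k t (xsection (h @^-1` (phi @^-1` [set r])) t).
Proof.
have mi r : measurable (xsection (h @^-1` (phi @^-1` [set r])) t).
  by apply: measurable_xsection; exact: mpre.
transitivity (\int[k t]_x \sum_(r \in range phi)
    (r%:E * (\1_(xsection (h @^-1` (phi @^-1` [set r])) t) x)%:E)).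
  apply: eq_integral => x _; rewrite fimfunE -fsumEFin//.
  apply: eq_fsbigr => r _; rewrite EFinM; congr (_ * (_)%:E).
  by rewrite !indicE mem_xsection.
rewrite ge0_integral_fsum//; last 2 first.
- by move=> r; apply/measurable_EFinP; apply: measurable_funM.
- move=> r x _; rewrite -EFinM lee_fin indicE.
  have [/set_mem/xsectionP/= <-|_] :=
    boolP (x \in xsection (h @^-1` (phi @^-1` [set r])) t); last by rewrite mulr0.
  by rewrite mulr1.
apply: eq_fsbigr => r; rewrite inE => -[u _ <-].
rewrite ge0_integralZl//; last by rewrite lee_fin.
  by rewrite integral_indic// setIT.
exact/measurable_EFinP.
Qed.

Let mix_nnsfun (phi : {nnsfun U >-> R}) :
  \int[mix]_u (phi u)%:E = \int[l]_t \int[k t]_x (phi (h (t, x)))%:E.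
Proof.
under [RHS]eq_integral do rewrite section_nnsfun.
rewrite integralT_nnsfun sintegralE ge0_integral_fsum//; last 2 first.
- by move=> r; apply: measurable_funeM; exact: mmix.
- move=> r t _; have [r0|r0] := leP 0%R r; first by rewrite mule_ge0.
  by rewrite preimage_nnfun0// preimage_set0 xsection0 measure0 mule0.
apply: eq_fsbigr => r; rewrite inE => -[u _ <-].
rewrite ge0_integralZl//; last by rewrite lee_fin.
exact: mmix.
Qed.

(** Simple functions first, then monotone limits; the measures k_t may have
    infinite total mass, as configurations do. *)
Lemma ge0_integral_mixture (f : U -> \bar R) : (forall u, 0 <= f u) ->
  measurable_fun [set: U] f ->
  \int[mix]_u f u = \int[l]_t \int[k t]_x f (h (t, x)).
Proof.
move=> f0 mf.
pose f_ := nnsfun_approx measurableT mf.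
have mf1 n t : measurable_fun [set: X] (fun x => (f_ n (h (t, x)))%:E).
  apply/measurable_EFinP; apply: (measurableT_comp (f := f_ n)) => //.
  by apply: (measurableT_comp mh); exact: measurable_pair1.
have mf2 n : measurable_fun [set: T] (fun t => \int[k t]_x (f_ n (h (t, x)))%:E).
  under eq_fun do rewrite section_nnsfun.
  by apply: emeasurable_fsum => //= r; apply: measurable_funeM; exact: mmix.
have nd_f n m u : (n <= m)%N -> (f_ n u)%:E <= (f_ m u)%:E.
  by move=> nm; rewrite lee_fin; apply/lefP; exact: nd_nnsfun_approx.
have f_f u : limn (fun n => (f_ n u)%:E) = f u.
  by apply/cvg_lim => //; exact: cvg_nnsfun_approx.
transitivity (limn (fun n => \int[mix]_u (f_ n u)%:E)).
  rewrite -monotone_convergence//.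
  - by apply: eq_integral => u _; rewrite f_f.
  - by move=> n; exact/measurable_EFinP.
  - by move=> n u _; rewrite lee_fin.
  - by move=> u _ n m; exact: nd_f.
under eq_fun do rewrite mix_nnsfun.
rewrite -monotone_convergence//.
- apply: eq_integral => t _; rewrite -monotone_convergence//.
  + by apply: eq_integral => x _; rewrite f_f.
  + by move=> n x _; rewrite lee_fin.
  + by move=> x _ n m; exact: nd_f.
- by move=> n t _; apply: integral_ge0 => x _; rewrite lee_fin.
- move=> t _ n m nm; apply: ge0_le_integral => //.
  + by move=> x _; rewrite lee_fin.
  + by move=> x _; exact: nd_f.
Qed.

End mixture.

(** * Measures on marked configurations are determined by counts on disjoint pieces *)

Section add_point.
Context (d : measure_display) (X : measurableType d) (R : realType).
Variable Y : exhaustion X.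

Lemma add_point_nat (m : config R Y) (p : X) A : measurable A -> bounded_in Y A ->
  exists k : nat, measure_add m (\d_p) A = k%:R%:E.
Proof.
move=> mA bA; have [k mk] := config_nat m mA bA.
by exists (k + (p \in A))%N; rewrite measure_addE mk /= /dirac indicE natrD EFinD.
Qed.

Definition add_point (m : config R Y) (p : X) : config R Y :=
  Config (add_point_nat m p).

Lemma add_pointE m p A : add_point m p A = (m A + (p \in A)%:R%:E)%E.
Proof. by rewrite [LHS](measure_addE m (\d_p)) /= /dirac indicE. Qed.

End add_point.

Section pieces.
Context (d : measure_display) (X : measurableType d) (R : realType).
Variable Y : exhaustion X.
Local Notation config := (config R Y).
Local Notation bounded := (bounded_in Y).

Record pieces (K : finType) (D : K -> set X) : Prop := Pieces {
  pieces_measurable : forall k, measurable (D k);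
  pieces_bounded : forall k, bounded (D k);
  pieces_trivIset : trivIset setT D }.

Definition determined_by (K : finType) (D : K -> set X) (E : set config) :=
  forall m m' : config, (forall k, m (D k) = m' (D k)) -> E m -> E m'.

(** Events depending on finitely many counts.  They are closed under
    intersection because two families of pieces have a common refinement, and
    they generate the events of configurations. *)
Definition determined (E : set config) :=
  exists (K : finType) (D : K -> set X), pieces D /\ determined_by D E.

Definition outside (I : finType) (D : I -> set X) (o : option I) : set X :=
  if o is Some i then D i else ~` \bigcup_i D i.

(** The common refinement of two families of disjoint sets.  The index [None]
    stands for the complement of a family; the pair of both complements, which
    is unbounded in general, is given the empty set so that all pieces remain
    bounded. *)
Definition meet_pieces (I J : finType) (D : I -> set X) (D' : J -> set X)
    (k : option I * option J) : set X :=
  if k is (None, None) then set0 else outside D k.1 `&` outside D' k.2.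

Lemma outside_measurable (I : finType) (D : I -> set X) o :
  (forall i, measurable (D i)) -> measurable (outside D o).
Proof.
case: o => [i|] mD //=.
apply: measurableC; apply: fin_bigcup_measurable => //; exact: finite_finset.
Qed.

Lemma outside_inj (I : finType) (D : I -> set X) o o' x : trivIset setT D ->
  outside D o x -> outside D o' x -> o = o'.
Proof.
case: o o' => [i|] [j|] tD //=.
- by move=> Di Dj; congr Some; apply: tD => //; exists x.
- by move=> Di; case; exists i.
- by move=> + Dj; case; exists j.
Qed.

Lemma outside_cover (I : finType) (D : I -> set X) x : exists o, outside D o x.
Proof.
have [[i _ Dix]|nD] := pselect ((\bigcup_i D i) x); first by exists (Some i).
by exists None.
Qed.

Section meet.
Variables (I J : finType) (D : I -> set X) (D' : J -> set X).
Hypotheses (pD : pieces D) (pD' : pieces D').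

Lemma pieces_meet : pieces (meet_pieces D D').
Proof.
have mO o := outside_measurable o (pieces_measurable pD).
have mO' o := outside_measurable o (pieces_measurable pD').
split.
- by move=> [[i|] [j|]] //=; apply: measurableI => //; [exact: (mO (Some i))|
    exact: (mO' (Some j))|exact: (mO (Some i))|exact: (mO' None)|
    exact: (mO None)|exact: (mO' (Some j))].
- move=> [[i|] [j|]] /=.
  + by apply: bounded_sub (pieces_bounded pD i); exact: subIsetl.
  + by apply: bounded_sub (pieces_bounded pD i); exact: subIsetl.
  + by apply: bounded_sub (pieces_bounded pD' j); exact: subIsetr.
  + by apply: bounded_sub (bounded_exh Y 0); exact: sub0set.
- have meet_out k x : meet_pieces D D' k x -> outside D k.1 x /\ outside D' k.2 x.
    by case: k => [[i|] [j|]].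
  move=> [u1 u2] [w1 w2] _ _ [x [/meet_out[a b] /meet_out[a1 b1]]].
  congr pair.
    exact: outside_inj (pieces_trivIset pD) a a1.
  exact: outside_inj (pieces_trivIset pD') b b1.
Qed.

Lemma meet_piecesl i : D i = \bigcup_(k in [set k | k.1 = Some i]) meet_pieces D D' k.
Proof.
apply/seteqP; split => [x Dix|x [[u1 u2] /= ->]].
  by have [u Du] := outside_cover D' x; exists (Some i, u).
by case: u2 => [j|] [].
Qed.

Lemma meet_piecesr j : D' j = \bigcup_(k in [set k | k.2 = Some j]) meet_pieces D D' k.
Proof.
apply/seteqP; split => [x Dix|x [[u1 u2] /= ->]].
  by have [u Du] := outside_cover D x; exists (u, Some j) => //; case: u Du.
by case: u1 => [i|] [].
Qed.

End meet.

(** The pieces are disjoint, so counts on the pieces add up to the counts on any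
    union of pieces. *)
Lemma determined_union (K : finType) (D : K -> set X) (P : set K) (m m' : config) :
  pieces D -> (forall k, m (D k) = m' (D k)) ->
  m (\bigcup_(k in P) D k) = m' (\bigcup_(k in P) D k).
Proof.
move=> pD mm'.
have mU (l : config) : l (\bigcup_(k in P) D k) = (\sum_(k \in P) l (D k))%E.
  rewrite measure_fin_bigcup//.
  - exact: finite_finset.
  - by apply: sub_trivIset (pieces_trivIset pD).
  - by move=> i _; exact: pieces_measurable.
by rewrite !mU; apply: eq_fsbigr.
Qed.

Lemma determined_meetl (I J : finType) (D : I -> set X) (D' : J -> set X) E :
  pieces D -> pieces D' -> determined_by D E -> determined_by (meet_pieces D D') E.
Proof.
move=> pD pD' DE m m' mm'; apply: DE => i.
by rewrite (meet_piecesl D D'); apply: determined_union => //; exact: pieces_meet.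
Qed.

Lemma determined_meetr (I J : finType) (D : I -> set X) (D' : J -> set X) E :
  pieces D -> pieces D' -> determined_by D' E -> determined_by (meet_pieces D D') E.
Proof.
move=> pD pD' DE m m' mm'; apply: DE => i.
by rewrite (meet_piecesr D D'); apply: determined_union => //; exact: pieces_meet.
Qed.

Lemma determinedI E E' : determined E -> determined E' -> determined (E `&` E').
Proof.
move=> [I [D [pD DE]]] [J [D' [pD' DE']]].
exists _, (meet_pieces D D'); split; first exact: pieces_meet.
move=> m m' mm' [Em E'm]; split.
  exact: (determined_meetl pD pD' DE mm').
exact: (determined_meetr pD pD' DE' mm').
Qed.

Lemma pieces1 A : measurable A -> bounded A -> pieces (fun _ : unit => A).
Proof. by move=> mA bA; split => // -[] []. Qed.

Lemma determined_eval A C : measurable A -> bounded A ->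
  determined [set m : config | C (m A)].
Proof.
move=> mA bA; exists unit, (fun=> A); split; first exact: pieces1.
by move=> m m' /(_ tt) /= ->.
Qed.

(** The counts are prescribed along a list of indices so that they can be
    exposed one index at a time. *)
Definition fiber (K : finType) (D : K -> set X) (s : seq K) (k : K -> nat) : set config :=
  [set m | forall i, i \in s -> m (D i) = (k i)%:R%:E].

Lemma measurable_fiber (K : finType) (D : K -> set X) s k : pieces D ->
  measurable (fiber D s k).
Proof.
move=> pD; elim: s => [|i s ih].
  by rewrite (_ : fiber _ _ _ = setT)//; apply/seteqP; split.
rewrite (_ : fiber _ _ _ =
    [set m : config | m (D i) = (k i)%:R%:E] `&` fiber D s k).
  apply: measurableI => //; rewrite -[X in measurable X]setTI.
  have := measurable_config_eval (R := R) (Y := Y) (pieces_measurable pD i).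
  by move=> /(_ measurableT [set (k i)%:R%:E]); exact.
apply/seteqP; split => [m h|m [h1 h2] j].
  by split => [|j js]; apply: h; rewrite inE ?eqxx// js orbT.
by rewrite inE => /predU1P[->|/h2].
Qed.

(** Counts on bounded sets are natural numbers, so an event is the countable
    disjoint union of its traces on the sets where one count is prescribed;
    induction on the list of indices. *)
Lemma eq_on_fibers (l1 l2 : {measure set (X * config) -> \bar R})
    (K : finType) (D : K -> set X) (A : set X) (E : set config) (s : seq K) :
  pieces D -> measurable A -> measurable E -> uniq s ->
  (forall k, l1 (A `*` (E `&` fiber D s k)) = l2 (A `*` (E `&` fiber D s k))) ->
  l1 (A `*` E) = l2 (A `*` E).
Proof.
move=> pD mA; elim: s E => [|i s ih] E mE /=.
  move=> _ /(_ (fun=> 0%N)).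
  by rewrite (_ : fiber _ _ _ = setT) ?setIT//; apply/seteqP; split.
move=> /andP[nis us] h.
pose El (l : nat) := E `&` [set m : config | m (D i) = l%:R%:E].
have mEl l : measurable (El l).
  apply: measurableI => //; rewrite -[X in measurable X]setTI.
  have := measurable_config_eval (R := R) (Y := Y) (pieces_measurable pD i).
  by move=> /(_ measurableT [set l%:R%:E]); exact.
have AE : A `*` E = \bigcup_l (A `*` El l).
  apply/seteqP; split => [[x m] [Ax Em]|[x m] [l _ [Ax [Em _]]]] //.
  have [l ml] := config_nat m (pieces_measurable pD i) (pieces_bounded pD i).
  by exists l.
have tEl : trivIset setT (fun l => A `*` El l).
  move=> l k _ _ [[x m] [[_ [_ ml]] [_ [_ mk]]]].
  have : (l%:R%:E : \bar R) = k%:R%:E by rewrite -[LHS]ml -[RHS]mk.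
  by case=> /eqP; rewrite eqr_nat => /eqP.
have mAEl l : measurable (A `*` El l) by exact: measurableX.
rewrite AE !measure_semi_bigcup//; [|exact: bigcupT_measurable..].
apply: eq_eseriesr => l _; apply: ih => // k.
have := h (fun j => if j == i then l else k j).
suff -> : E `&` fiber D (i :: s) (fun j => if j == i then l else k j) =
  El l `&` fiber D s k by [].
apply/seteqP; split => m.
  move=> [Em hm]; split; first by split => //=; rewrite hm ?mem_head ?eqxx.
  move=> j js; rewrite hm; last by rewrite inE js orbT.
  by case: eqP => // ji; rewrite -ji js in nis.
move=> [[Em mi] hm]; split => // j; rewrite inE.
by case: eqP => [->|_] //= js; exact: hm.
Qed.

End pieces.
Arguments fiber {d X R Y K} D s k.

Section uniqueness.
Context (d : measure_display) (X : measurableType d) (R : realType).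
Variable Y : exhaustion X.
Variables l1 l2 : {measure set (X * config R Y) -> \bar R}.
Hypothesis l1_l2_fiber : forall (K : finType) (D : K -> set X) (k : K -> nat) J,
  pieces Y D ->
  l1 (D J `*` fiber D (enum K) k) = l2 (D J `*` fiber D (enum K) k).
Hypothesis l2_finite : forall j, (l2 (Y j `*` setT) < +oo)%E.

Let l1_l2_rect (A : set X) (E : set (config R Y)) :
  measurable A -> bounded_in Y A -> measurable E -> determined E ->
  l1 (A `*` E) = l2 (A `*` E).
Proof.
move=> mA bA mE [I [D0 [pD0 D0E]]].
have pA := pieces1 mA bA.
pose D := meet_pieces D0 (fun _ : unit => A).
have pD : pieces Y D by exact: pieces_meet.
have DE : determined_by D E by exact: determined_meetl.
rewrite (meet_piecesr D0 (fun _ : unit => A) tt) -/D.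
have -> (P : set (option I * option unit)) :
    (\bigcup_(k in P) D k) `*` E = \bigcup_(k in P) (D k `*` E).
  apply/seteqP; split => [[x m] [[k Pk Dk] Em]|[x m] [k Pk [Dk Em]]].
    by exists k.
  by split => //; exists k.
have tDE : trivIset setT (fun k => D k `*` E).
  move=> i j _ _ [[x m] [[Di _] [Dj _]]].
  by apply: (pieces_trivIset pD) => //; exists x.
have sum_pieces (l : {measure set (X * config R Y) -> \bar R})
    (P : set (option I * option unit)) :
    l (\bigcup_(k in P) (D k `*` E)) = (\sum_(k \in P) l (D k `*` E))%E.
  apply: measure_fin_bigcup; first exact: finite_finset.
    by apply: sub_trivIset tDE.
  by move=> k _; apply: measurableX => //; exact: (pieces_measurable pD).
rewrite !sum_pieces; apply: eq_fsbigr => J _.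
apply: (@eq_on_fibers _ _ _ _ l1 l2 _ D (D J) E (enum {: option I * option unit}) pD) => //.
- exact: (pieces_measurable pD).
- exact: enum_uniq.
- move=> k; set F := fiber D _ k.
  have [[m [Em km]]|nE] := pselect ((E `&` F) !=set0).
    suff -> : E `&` F = F by exact: l1_l2_fiber.
    apply/seteqP; split => [m' []//|m' km']; split => //.
    by apply: DE Em => i; rewrite km ?km'// mem_enum.
  have -> : E `&` F = set0 by rewrite -subset0 => m Em; apply: nE; exists m.
  by rewrite setX0 !measure0.
Qed.

(** On a rectangle A x E, with E determined by counts on pieces, refine the
    pieces by A: the rectangle splits into finitely many products of a piece and
    E, and E splits along the fibers, on each of which it is all or nothing.
    Such rectangles are stable under intersection and generate the product, so
    the uniqueness theorem for measures concludes. *)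
Lemma eq_on_pieces W : measurable W -> l1 W = l2 W.
Proof.
pose G : set (set (X * config R Y)) := [set A `*` E |
  A in [set A | measurable A /\ bounded_in Y A] &
  E in [set E | measurable E /\ determined E]].
have mY := exh_measurable Y.
have bY := bounded_exh Y.
have GT A E : measurable A -> measurable E -> determined E -> <<s G >> (A `*` E).
  move=> mA mE dE; rewrite (_ : A `*` E = \bigcup_j ((A `&` Y j) `*` E)).
    apply: (@sigma_algebra_bigcup _ setT G) => j; apply: sub_sigma_algebra.
    exists (A `&` Y j); last by exists E.
    split; first exact: measurableI.
    by apply: bounded_sub (bY j); exact: subIsetr.
  apply/seteqP; split => [[x m] [Ax Em]|[x m] [j _ [[Ax _] Em]]] //.
  have [j _ Yjx] : (\bigcup_j Y j) x by rewrite exh_cover.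
  by exists j.
have dT : determined [set: config R Y].
  by exists unit, (fun=> set0); split; first exact:
    (pieces1 measurable0 (bounded_sub (@sub0set _ _) (bY 0%N))).
(* The rectangles generate the product: both projections are measurable for
   the sigma-algebra that they generate. *)
have GE : measurable = <<s G >>.
  apply/seteqP; split; last first.
    apply: smallest_sub; first exact: sigma_algebra_measurable.
    by move=> _ [A [mA bA] [E [mE dE] <-]]; exact: measurableX.
  suff mid : measurable_fun [set: g_sigma_algebraType G]
      (fun z : g_sigma_algebraType G => (z.1, z.2) : X * config R Y).
    move=> U mU; have := mid measurableT U mU; rewrite setTI.
    by congr (<<s G >> _); apply/seteqP; split => -[].
  apply: measurable_fun_pair.
    move=> _ A mA; rewrite setTI.
    rewrite (_ : _ @^-1` _ = A `*` setT); first exact: GT.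
    by apply/seteqP; split => [[x m]|[x m] []].
  apply: measurable_to_config => A mA bA _ C mC; rewrite setTI.
  rewrite (_ : _ @^-1` _ = setT `*` [set m : config R Y | C (m A)]).
    apply: GT => //; last exact: determined_eval.
    rewrite -[X in measurable X]setTI.
    exact: (measurable_config_eval (R := R) (Y := Y) mA).
  by apply/seteqP; split => [[x m]|[x m] []].
apply: (measure_unique G (fun j => exh_set Y j `*` setT)) => //.
- move=> _ _ [A [mA bA] [E [mE dE] <-]] [B [mB bB] [F [mF dF] <-]].
  rewrite -setXI; exists (A `&` B).
    by split; [exact: measurableI|apply: bounded_sub bA; exact: subIsetl].
  by exists (E `&` F) => //; split; [exact: measurableI|exact: determinedI].
- by move=> j; exists (Y j) => //; exists setT.
- rewrite -subTset => -[x m] _.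
  have [j _ Yjx] : (\bigcup_j Y j) x by rewrite exh_cover.
  by exists j.
- by move=> _ [A [mA bA] [E [mE dE] <-]]; exact: l1_l2_rect.
- by move=> j; rewrite l1_l2_rect.
Qed.

End uniqueness.

(** * Mecke's formula for Poisson processes *)

Definition poisson_weight (R : realType) (r : R) (k : nat) : R :=
  r ^+ k / k`!%:R * expR (- r).

(** The identity behind Mecke's formula: weighting by the number of points
    amounts to removing one point and multiplying by the intensity. *)
Lemma poisson_weightS (R : realType) (r : R) k :
  k.+1%:R * poisson_weight r k.+1 = r * poisson_weight r k.
Proof.
rewrite /poisson_weight factS natrM exprS.
have k0 : k.+1%:R != 0 :> R by rewrite pnatr_eq0.
have f0 : k`!%:R != 0 :> R by rewrite pnatr_eq0 -lt0n fact_gt0.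
by field; rewrite f0 addrC natr1.
Qed.

Section mecke.
Local Open Scope ereal_scope.
Context (d : measure_display) (X : measurableType d) (R : realType).
Variable Y : exhaustion X.
Context (dO : measure_display) (Omega : measurableType dO).
Variables (Q : probability Omega R) (nu : {sigma_finite_measure set X -> \bar R}).

(** The void probabilities are asked for all sets of finite intensity, bounded
    or not: the region under a graph G need not be bounded. *)
Record poisson_law (N : Omega -> config R Y) : Prop := PoissonLaw {
  poisson_law_measurable : measurable_fun [set: Omega] N;
  poisson_law_finite : forall A, measurable A -> bounded_in Y A -> nu A < +oo;
  poisson_law_joint : forall (K : finType) (D : K -> set X) (k : K -> nat),
    pieces Y D -> Q [set w | forall i, N w (D i) = (k i)%:R%:E] =
    (\prod_i poisson_weight (fine (nu (D i))) (k i))%:E;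
  poisson_law_void : forall A, measurable A -> nu A < +oo ->
    Q [set w | N w A = 0] = (expR (- fine (nu A)))%:E }.

Variable N : Omega -> config R Y.
Hypothesis pN : poisson_law N.
Let mN := poisson_law_measurable pN.

Let mNfst : measurable_fun [set: Omega * X] (fun z => N z.1).
Proof. exact: measurableT_comp. Qed.

Lemma measurable_add_point :
  measurable_fun [set: Omega * X] (fun z => add_point (N z.1) z.2).
Proof.
apply: measurable_to_config => A mA bA.
under eq_fun do rewrite add_pointE.
apply: emeasurable_funD.
  by apply: (measurableT_comp (measurable_config_eval mA) mNfst).
apply/measurable_EFinP.
under eq_fun do rewrite -indicE.
have mi : measurable_fun [set: X] (\1_A : X -> R) by exact: measurable_indic.
by apply: (measurableT_comp mi); exact: measurable_snd.
Qed.

Let h1 (z : Omega * X) := (z.2, N z.1).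
Let h2 (z : Omega * X) := (z.2, add_point (N z.1) z.2).

Let mh1 : measurable_fun [set: Omega * X] h1.
Proof. by apply: measurable_fun_pair => //; exact: measurable_snd. Qed.

Let mh2 : measurable_fun [set: Omega * X] h2.
Proof.
by apply: measurable_fun_pair; [exact: measurable_snd|exact: measurable_add_point].
Qed.

Let mk2 (A : set (Omega * X)) : measurable A ->
  measurable_fun [set: Omega] (fun w => nu (xsection A w)).
Proof. exact: measurable_fun_xsection. Qed.

Let C1 : {measure set (X * config R Y) -> \bar R} :=
  mixture Q (measurable_xsection_config mN) mh1.
Let C2 : {measure set (X * config R Y) -> \bar R} := mixture Q mk2 mh2.

Let mfib (K : finType) (D : K -> set X) (k : K -> nat) : pieces Y D ->
  measurable [set w | forall i, N w (D i) = (k i)%:R%:E].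
Proof.
move=> pD.
have := mN measurableT (measurable_fiber (R := R) (enum K) k pD).
rewrite setTI; congr measurable; apply/seteqP; split => w /= h i.
  by apply: h; rewrite mem_enum.
by move=> _; exact: h.
Qed.

Let QE (F : set Omega) : measurable F -> Q F = \int[Q]_w (\1_F w)%:E.
Proof. by move=> mF; rewrite integral_indic// setIT. Qed.

Let C1_fiber (K : finType) (D : K -> set X) (k : K -> nat) J : pieces Y D ->
  C1 (D J `*` fiber D (enum K) k) =
  ((k J)%:R * \prod_i poisson_weight (fine (nu (D i))) (k i))%:E.
Proof.
move=> pD; rewrite EFinM -(poisson_law_joint pN k pD).
rewrite QE; last exact: mfib.
rewrite -ge0_integralZl//; last exact/measurable_EFinP/measurable_indic/mfib.
apply: eq_integral => w _; rewrite indicE.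
have [/set_mem /= wF|/negP wF] := boolP (w \in _).
  rewrite mule1 -(wF J); congr (N w _); apply/seteqP; split => x.
    by move=> /xsectionP[].
  by move=> Dx; apply/xsectionP; split => //= i _; exact: wF.
rewrite mule0 (_ : xsection _ _ = set0) ?measure0//.
apply/seteqP; split => // x /xsectionP[_ /= h]; apply: wF; rewrite inE /= => i.
by apply: h; rewrite mem_enum.
Qed.

(** If the added point falls in the piece J, then the count of J is positive. *)
Let C2_fiber0 (K : finType) (D : K -> set X) (k : K -> nat) J : pieces Y D ->
  k J = 0%N -> C2 (D J `*` fiber D (enum K) k) = 0.
Proof.
move=> pD kJ; apply: integral0_eq => w _.
rewrite (_ : xsection _ _ = set0) ?measure0//.
apply/seteqP; split => // x /xsectionP[/= Dx /(_ J)].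
rewrite mem_enum add_pointE kJ mem_set// => /(_ isT) /= h.
have : 0 <= N w (D J) by [].
have := config_fin_num (N w) (pieces_measurable pD J) (pieces_bounded pD J).
move: h; case: (N w (D J)) => [r| |]//= -[] /eqP.
by rewrite addr_eq0 => /eqP -> _; rewrite lee_fin oppr_ge0 ler10.
Qed.

(** A point added in the piece J raises the count of J by one and leaves the
    others alone, so the fiber is pulled back to the one with k J lowered by
    one. *)
Let C2_fiber (K : finType) (D : K -> set X) (k : K -> nat) J : pieces Y D ->
  (0 < k J)%N -> C2 (D J `*` fiber D (enum K) k) =
  nu (D J) *
  (\prod_i poisson_weight (fine (nu (D i))) (k i - (i == J))%N)%:E.
Proof.
move=> pD kJ; rewrite -(poisson_law_joint pN (fun i => k i - (i == J))%N pD).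
rewrite QE; last exact: mfib.
rewrite -ge0_integralZl//; last exact/measurable_EFinP/measurable_indic/mfib.
have shift w x i : D J x -> N w (D i) = (k i - (i == J))%N%:R%:E <->
    add_point (N w) x (D i) = (k i)%:R%:E.
  move=> Dx; rewrite add_pointE.
  have -> : (x \in D i) = (i == J).
    apply/idP/eqP => [/set_mem Dix|->]; last exact/mem_set.
    by apply: (pieces_trivIset pD) => //; exists x.
  have [l ->] := config_nat (N w) (pieces_measurable pD i) (pieces_bounded pD i).
  rewrite -EFinD -natrD; split => [[/eqP]|[/eqP]]; rewrite eqr_nat => /eqP.
    by move=> ->; rewrite subnK//; case: eqP => // ->.
  by move=> <-; rewrite addnK.
apply: eq_integral => w _; rewrite indicE.
have [/set_mem /= wF|/negP wF] := boolP (w \in _).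
  rewrite mule1; congr (nu _); apply/seteqP; split => x.
    by move=> /xsectionP[].
  by move=> Dx; apply/xsectionP; split => //= i _; exact/(shift w x i Dx)/wF.
rewrite mule0 (_ : xsection _ _ = set0) ?measure0//.
apply/seteqP; split => // x /xsectionP[/= Dx h]; apply: wF; rewrite inE /=.
by move=> i; apply/(shift w x i Dx)/h; rewrite mem_enum.
Qed.

Let C1_C2_fiber (K : finType) (D : K -> set X) (k : K -> nat) J : pieces Y D ->
  C1 (D J `*` fiber D (enum K) k) = C2 (D J `*` fiber D (enum K) k).
Proof.
move=> pD; rewrite C1_fiber//.
have [kJ|kJ] := posnP (k J); first by rewrite kJ mul0r C2_fiber0.
have nuJ := poisson_law_finite pN (pieces_measurable pD J) (pieces_bounded pD J).
rewrite C2_fiber// -[nu (D J)]fineK; last by rewrite ge0_fin_numE.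
rewrite -EFinM (bigD1 J)//= [in RHS](bigD1 J)//= eqxx.
have -> : (\prod_(i | i != J) poisson_weight (fine (nu (D i))) (k i - (i == J))%N =
    \prod_(i | i != J) poisson_weight (fine (nu (D i))) (k i))%R.
  by apply: eq_bigr => i /negbTE ->; rewrite subn0.
by case: (k J) kJ => // l _; rewrite subn1 mulrA poisson_weightS -mulrA.
Qed.

Let C2_finite j : C2 (Y j `*` setT) < +oo.
Proof.
rewrite [ltLHS](_ : _ = nu (Y j)).
  exact: (poisson_law_finite pN (exh_measurable Y j) (bounded_exh Y j)).
rewrite -[RHS]mule1 -(@probability_setT _ _ _ Q) -integral_cst//.
apply: eq_integral => w _; congr (nu _); apply/seteqP; split => x.
  by move=> /xsectionP[].
by move=> Yx; apply/xsectionP.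
Qed.

(** Both sides are integrals of F against mixtures, which agree on products of a
    piece and a fiber by [poisson_weightS]. *)
Theorem mecke (F : X * config R Y -> \bar R) :
  (forall z, 0 <= F z) -> measurable_fun [set: X * config R Y] F ->
  \int[Q]_w \int[N w]_p F (p, N w) =
  \int[Q]_w \int[nu]_p F (p, add_point (N w) p).
Proof.
move=> F0 mF.
have <- : \int[C1]_z F z = \int[Q]_w \int[N w]_p F (p, N w).
  by rewrite ge0_integral_mixture.
have <- : \int[C2]_z F z = \int[Q]_w \int[nu]_p F (p, add_point (N w) p).
  by rewrite ge0_integral_mixture.
apply: eq_measure_integral => W mW _.
exact: (eq_on_pieces C1_C2_fiber C2_finite mW).
Qed.

End mecke.

(** * The sum over admissible chains *)

Lemma measurable_invr (R : realType) : measurable_fun [set: R] (@GRing.inv R).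
Proof.
rewrite (_ : @GRing.inv R = fun x => if 0 < x then expR (- ln x) else
    if x < 0 then - expR (- ln (- x)) else 0); last first.
  apply/funext => x; case: ltrgt0P => [x0|x0|->]; last by rewrite invr0.
    by rewrite expRN lnK.
  by rewrite expRN lnK ?invrN ?opprK// posrE oppr_gt0.
have mexp := @measurable_expR R; have mln := @measurable_ln R.
have mopp : measurable_fun [set: R] (@GRing.opp R).
  by apply: measurable_funN; exact: measurable_id.
apply: measurable_fun_ifT; first exact: measurable_fun_ltr.
  apply: (measurableT_comp mexp); apply: measurable_funN; exact: mln.
apply: measurable_fun_ifT; first exact: measurable_fun_ltr.
  apply: measurable_funN; apply: (measurableT_comp mexp); apply: measurable_funN.
  exact: (measurableT_comp mln).
exact: measurable_cst.
Qed.

Lemma measurable_set_bool (dT : measure_display) (T : measurableType dT)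
    (b : T -> bool) :
  measurable_fun [set: T] b -> measurable [set t | b t].
Proof. by move=> mb; rewrite -[X in measurable X]setTI; exact: (mb measurableT [set true]). Qed.

Section functional.
Context (d : measure_display) (R : realType) (S : measurableCompleteMetricType d R).
Local Notation X := (S * measurableTypeR R)%type.
Variable Y : exhaustion X.
Variables (g : S -> S -> R) (y0 : S) (D : set S) (h : R -> R).
Hypothesis g_measurable : measurable_fun [set: S * S] (fun p : S * S => g p.1 p.2).
Hypothesis mD : measurable D.
Hypothesis mh : measurable_fun [set: R] h.
Hypothesis h_ge0 : forall a, 0 <= h a.

(** Used points are recognised by their heights: the set of used heights is
    finite, hence measurable, and almost surely no two points of the process
    have the same height. *)
Definition used_height (s : slt_state S) (v : R) : bool :=
  `[< exists2 q, slt_used s q & q.2 = v >].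

(** The increment xi that makes the graph of G meet the point p. *)
Definition rise (s : slt_state S) (p : S * R) : R :=
  (p.2 - slt_G s p.1) / g (slt_z s) p.1.

Definition slt_next (s : slt_state S) (p : S * R) : slt_state S :=
  SltState (fun y => slt_G s y + rise s p * g (slt_z s) y) (p |` slt_used s) p.1.

Definition reachable (s : slt_state S) (p : S * R) : bool :=
  [&& ~~ used_height s p.2, 0 < g (slt_z s) p.1 & slt_G s p.1 < p.2].

(** The points that the construction would already have met. *)
Definition below (s : slt_state S) : set X :=
  [set p | (p.2 <= slt_G s p.1) && ~~ used_height s p.2].

Definition strip (v : R) : set X := [set q | q.2 == v].

Local Open Scope ereal_scope.

Definition final_term (s : slt_state S) (m : config R Y) : \bar R :=
  (h (slt_G s y0))%:E * (\1_[set 0 : \bar R] (m (below s)))%:E.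

(** The height of the new point is required to carry exactly one point, counted
    with multiplicity.  After this, discarding its height discards the point and
    nothing else. *)
Definition admits (s : slt_state S) (m : config R Y) (p : X) : \bar R :=
  if reachable s p then (\1_[set 1%:E : \bar R] (m (strip p.2)))%:E else 0.

Definition step_term (H : slt_state S -> config R Y -> \bar R)
    (s : slt_state S) (m : config R Y) (p : X) : \bar R :=
  admits s m p *
  (if p.1 \in D then final_term (slt_next s p) m else H (slt_next s p) m).

(** Only the final term tests that no point has been missed.  Since the graphs
    increase, this also shows that each intermediate point was the first one to
    be met. *)
Fixpoint chain_sum (n : nat) : slt_state S -> config R Y -> \bar R :=
  if n is n'.+1 then fun s m => \int[m]_p step_term (chain_sum n') s m p
  else final_term.

Lemma final_term_ge0 s m : 0 <= final_term s m.
Proof. by rewrite mule_ge0// lee_fin. Qed.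

Lemma admits_ge0 s m p : 0 <= admits s m p.
Proof. by rewrite /admits; case: ifP => // _; rewrite lee_fin. Qed.

Lemma step_term_ge0 (H : slt_state S -> config R Y -> \bar R) s m p :
  (forall s m, 0 <= H s m) -> 0 <= step_term H s m p.
Proof.
move=> H0; rewrite /step_term mule_ge0 ?admits_ge0//.
by case: ifP => _ //; exact: final_term_ge0.
Qed.

Lemma chain_sum_ge0 n s m : 0 <= chain_sum n s m.
Proof.
elim: n s m => [|n ih] s m /=; first exact: final_term_ge0.
by apply: integral_ge0 => p _; exact: step_term_ge0.
Qed.

(** Joint measurability, with an arbitrary parameter [t]: the induction on the
    length of the chain adds one point to the parameter at each step. *)
Record measurable_state (dT : measure_display) (T : measurableType dT)
    (s : T -> slt_state S) : Prop := MeasurableState {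
  measurable_state_z : measurable_fun [set: T] (fun t => slt_z (s t));
  measurable_state_G : measurable_fun [set: T * S] (fun u => slt_G (s u.1) u.2);
  measurable_state_used :
    measurable_fun [set: T * R] (fun u => used_height (s u.1) u.2) }.

Section measurable_step.
Context (dT : measure_display) (T : measurableType dT) (s : T -> slt_state S).
Hypothesis ms : measurable_state s.

Lemma measurable_G_comp (dZ : measure_display) (Z : measurableType dZ)
    (t : Z -> T) (y : Z -> S) :
  measurable_fun [set: Z] t -> measurable_fun [set: Z] y ->
  measurable_fun [set: Z] (fun u => slt_G (s (t u)) (y u)).
Proof.
move=> mt my.
exact: (measurableT_comp (measurable_state_G ms) (measurable_fun_pair mt my)).
Qed.

Lemma measurable_used_comp (dZ : measure_display) (Z : measurableType dZ)
    (t : Z -> T) (v : Z -> R) :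
  measurable_fun [set: Z] t -> measurable_fun [set: Z] v ->
  measurable_fun [set: Z] (fun u => used_height (s (t u)) (v u)).
Proof.
move=> mt mv.
exact: (measurableT_comp (measurable_state_used ms) (measurable_fun_pair mt mv)).
Qed.

Lemma measurable_g_comp (dZ : measure_display) (Z : measurableType dZ)
    (t : Z -> T) (y : Z -> S) :
  measurable_fun [set: Z] t -> measurable_fun [set: Z] y ->
  measurable_fun [set: Z] (fun u => g (slt_z (s (t u))) (y u)).
Proof.
move=> mt my; have mz := measurableT_comp (measurable_state_z ms) mt.
exact: (measurableT_comp g_measurable (measurable_fun_pair mz my)).
Qed.

Lemma measurable_rise (dZ : measure_display) (Z : measurableType dZ)
    (t : Z -> T) (p : Z -> X) :
  measurable_fun [set: Z] t -> measurable_fun [set: Z] p ->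
  measurable_fun [set: Z] (fun u => rise (s (t u)) (p u)).
Proof.
move=> mt mp.
have mp1 : measurable_fun [set: Z] (fun u => (p u).1).
  by apply: (measurableT_comp measurable_fst).
have mp2 : measurable_fun [set: Z] (fun u => (p u).2 : R).
  by apply: (measurableT_comp measurable_snd).
apply: measurable_funM.
  by apply: measurable_funB => //; exact: measurable_G_comp.
exact: (measurableT_comp (@measurable_invr R) (measurable_g_comp mt mp1)).
Qed.

Lemma measurable_reachable (dZ : measure_display) (Z : measurableType dZ)
    (t : Z -> T) (p : Z -> X) :
  measurable_fun [set: Z] t -> measurable_fun [set: Z] p ->
  measurable_fun [set: Z] (fun u => reachable (s (t u)) (p u)).
Proof.
move=> mt mp.
have mp1 : measurable_fun [set: Z] (fun u => (p u).1).
  by apply: (measurableT_comp measurable_fst).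
have mp2 : measurable_fun [set: Z] (fun u => (p u).2 : R).
  by apply: (measurableT_comp measurable_snd).
apply: measurable_and; first by apply: measurable_neg; exact: measurable_used_comp.
apply: measurable_and; apply: measurable_fun_ltr => //.
  exact: measurable_g_comp.
exact: measurable_G_comp.
Qed.

Lemma measurable_next :
  measurable_state (fun u : T * X => slt_next (s u.1) u.2).
Proof.
have m2 : measurable_fun [set: T * X] snd by exact: measurable_snd.
split => /=.
- by apply: (measurableT_comp measurable_fst).
- have m11 : measurable_fun [set: (T * X) * S] (fun u => u.1.1).
    by apply: (measurableT_comp measurable_fst); exact: measurable_fst.
  have m12 : measurable_fun [set: (T * X) * S] (fun u => u.1.2).
    by apply: (measurableT_comp measurable_snd); exact: measurable_fst.
  have m2' : measurable_fun [set: (T * X) * S] snd by exact: measurable_snd.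
  apply: measurable_funD; first exact: measurable_G_comp.
  apply: measurable_funM; first exact: measurable_rise.
  exact: measurable_g_comp.
- have m11 : measurable_fun [set: (T * X) * R] (fun u => u.1.1).
    by apply: (measurableT_comp measurable_fst); exact: measurable_fst.
  have m12 : measurable_fun [set: (T * X) * R] (fun u => u.1.2.2 : R).
    apply: (measurableT_comp measurable_snd).
    by apply: (measurableT_comp measurable_snd); exact: measurable_fst.
  have m2' : measurable_fun [set: (T * X) * R] snd by exact: measurable_snd.
  rewrite (_ : (fun _ => _) = fun u : (T * X) * R =>
      (u.1.2.2 == u.2 :> R) || used_height (s u.1.1) u.2).
    apply: measurable_or; last exact: measurable_used_comp.
    exact: measurable_fun_eqr.
  apply/funext => u /=; apply/idP/idP => [/asboolP[q [->|sq] <-]|/orP[/eqP <-|]].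
  + by rewrite eqxx.
  + by apply/orP; right; apply/asboolP; exists q.
  + by apply/asboolP; exists u.1.2 => //; left.
  + by move=> /asboolP[q sq <-]; apply/asboolP; exists q => //; right.
Qed.

End measurable_step.

Section measurable_functional.
Context (dT : measure_display) (T : measurableType dT) (s : T -> slt_state S).
Hypothesis ms : measurable_state s.

Lemma measurable_final_term :
  measurable_fun [set: T * config R Y] (fun u => final_term (s u.1) u.2).
Proof.
have m1 : measurable_fun [set: T * config R Y] fst by exact: measurable_fst.
apply: emeasurable_funM; apply/measurable_EFinP.
  by apply: (measurableT_comp mh); apply: (measurable_G_comp ms).
have mi : measurable_fun [set: \bar R] (\1_[set 0 : \bar R] : \bar R -> R).
  exact: measurable_indic.
apply: (measurableT_comp mi).
pose A : set ((T * config R Y) * X) := [set u | below (s u.1.1) u.2].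
have mA : measurable A.
  have m11 : measurable_fun [set: (T * config R Y) * X] (fun u => u.1.1).
    by apply: (measurableT_comp measurable_fst); exact: measurable_fst.
  have m21 : measurable_fun [set: (T * config R Y) * X] (fun u => u.2.1).
    by apply: (measurableT_comp measurable_fst); exact: measurable_snd.
  have m22 : measurable_fun [set: (T * config R Y) * X] (fun u => u.2.2 : R).
    by apply: (measurableT_comp measurable_snd); exact: measurable_snd.
  apply: measurable_set_bool; apply: measurable_and.
    by apply: measurable_fun_ler => //; exact: (measurable_G_comp ms m11 m21).
  by apply: measurable_neg; exact: (measurable_used_comp ms m11 m22).
have := @measurable_xsection_config _ X R Y _ (T * config R Y)%type snd measurable_snd A mA.
congr (measurable_fun _ _); apply/funext => u; congr (u.2 _).
by apply/seteqP; split => x; [move=> /xsectionP|move=> xA; apply/xsectionP].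
Qed.

Lemma measurable_admits :
  measurable_fun [set: (T * config R Y) * X] (fun u => admits (s u.1.1) u.1.2 u.2).
Proof.
have m11 : measurable_fun [set: (T * config R Y) * X] (fun u => u.1.1).
  by apply: (measurableT_comp measurable_fst); exact: measurable_fst.
have m12 : measurable_fun [set: (T * config R Y) * X] (fun u => u.1.2).
  by apply: (measurableT_comp measurable_snd); exact: measurable_fst.
have m2 : measurable_fun [set: (T * config R Y) * X] snd by exact: measurable_snd.
apply: measurable_fun_ifT; first exact: (measurable_reachable ms).
  apply/measurable_EFinP.
  have mi : measurable_fun [set: \bar R] (\1_[set 1%:E : \bar R] : \bar R -> R).
    exact: measurable_indic.
  apply: (measurableT_comp mi).
  pose A : set (((T * config R Y) * X) * X) := [set u | u.2.2 == u.1.2.2 :> R].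
  have mA : measurable A.
    apply: measurable_set_bool; apply: measurable_fun_eqr.
      by apply: (measurableT_comp measurable_snd); exact: measurable_snd.
    apply: (measurableT_comp measurable_snd); apply: (measurableT_comp measurable_snd).
    exact: measurable_fst.
  have := @measurable_xsection_config _ X R Y _ _ _ m12 A mA.
  congr (measurable_fun _ _); apply/funext => u; congr (u.1.2 _).
  by apply/seteqP; split => x; [move=> /xsectionP|move=> xA; apply/xsectionP].
exact: measurable_cst.
Qed.

End measurable_functional.

Lemma measurable_step_term_of (H : slt_state S -> config R Y -> \bar R) :
  (forall (dT : measure_display) (T : measurableType dT) (s : T -> slt_state S),
    measurable_state s ->
    measurable_fun [set: T * config R Y] (fun u => H (s u.1) u.2)) ->
  forall (dT : measure_display) (T : measurableType dT) (s : T -> slt_state S),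
  measurable_state s ->
  measurable_fun [set: (T * config R Y) * X]
    (fun u => step_term H (s u.1.1) u.1.2 u.2).
Proof.
move=> mH dT T s ms.
have ms' := measurable_next ms.
have mswap : measurable_fun [set: (T * config R Y) * X]
    (fun u => ((u.1.1, u.2), u.1.2)).
  apply: measurable_fun_pair.
    apply: measurable_fun_pair; last exact: measurable_snd.
    by apply: (measurableT_comp measurable_fst); exact: measurable_fst.
  by apply: (measurableT_comp measurable_snd); exact: measurable_fst.
apply: emeasurable_funM; first exact: measurable_admits.
apply: measurable_fun_ifT.
- have mDb : measurable_fun [set: S] (fun y => y \in D).
    apply: (measurable_fun_bool true); rewrite setTI.
    by rewrite (_ : _ @^-1` _ = D)//; apply/seteqP; split => y /=; [exact: set_mem|exact: mem_set].
  apply: (measurableT_comp mDb); apply: (measurableT_comp measurable_fst).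
  exact: measurable_snd.
- exact: (measurableT_comp (measurable_final_term ms') mswap).
- exact: (measurableT_comp (mH _ _ _ ms') mswap).
Qed.

(** The statement quantifies over the parameter space, because the inductive
    hypothesis is used for the parameter enlarged by the integrated point. *)
Lemma measurable_chain_sum n (dT : measure_display) (T : measurableType dT)
    (s : T -> slt_state S) : measurable_state s ->
  measurable_fun [set: T * config R Y] (fun u => chain_sum n (s u.1) u.2).
Proof.
elim: n dT T s => [|n ih] dT T s ms /=; first exact: measurable_final_term.
apply: (@measurable_integral_config _ X R Y _ (T * config R Y)%type snd measurable_snd
  (fun u => step_term (chain_sum n) (s u.1.1) u.1.2 u.2)).
  by move=> u; apply: step_term_ge0 => *; exact: chain_sum_ge0.
exact: measurable_step_term_of.
Qed.

Lemma measurable_step_term n (dT : measure_display) (T : measurableType dT)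
    (s : T -> slt_state S) : measurable_state s ->
  measurable_fun [set: (T * config R Y) * X]
    (fun u => step_term (chain_sum n) (s u.1.1) u.1.2 u.2).
Proof.
by move=> ms; apply: measurable_step_term_of => // *; exact: measurable_chain_sum.
Qed.

End functional.

(** * Exponential integrals over the half-line *)

Section halfline.
Context (R : realType).
Local Notation leb := (@lebesgue_measure R).

Definition halfline_measure : set (measurableTypeR R) -> \bar R :=
  mrestr leb (measurable_itv (`[0%R, +oo[ : interval R)).

HB.instance Definition _ := Measure.on halfline_measure.

Lemma sigma_finite_halfline : sigma_finite setT halfline_measure.
Proof.
have [F FT Foo] := sigma_finiteT leb; exists F => // i.
have [mF Fi] := Foo i; split => //; apply: le_lt_trans Fi.
by apply: le_measure; rewrite ?inE//; exact: measurableI.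
Qed.

HB.instance Definition _ :=
  Measure_isSigmaFinite.Build _ _ _ halfline_measure sigma_finite_halfline.

Definition quad (x0 x1 x2 t : R) : R := x0 + x1 * t + x2 * t ^+ 2.

Section exp_poly.
Variables (x0 x1 x2 : R).
Hypotheses (x00 : 0 <= x0) (x10 : 0 <= x1) (x20 : 0 <= x2).

Let p := quad x0 x1 x2.
Let q (t : R) : R := x2 * t ^+ 2 + (x1 + 2 * x2) * t + (x0 + x1 + 2 * x2).
Let G (t : R) : R := expR (- t) * q t.

Let dG (t : R) : is_derive t (1 : R) G (- (expR (- t) * p t)).
Proof.
have dexp := is_derive1_comp (is_derive_expR (- t)) (is_deriveNid t (1 : R)).
have did := is_derive_id t (1 : R).
have dq := is_deriveD (is_deriveD (is_deriveZ x2 (is_deriveM did did))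
  (is_deriveZ (x1 + 2 * x2) did)) (is_derive_cst (x0 + x1 + 2 * x2) t (1 : R)).
apply: (is_derive_eq (is_deriveM dexp dq)).
change (expR (- t) * (x2 * (t * 1 + t * 1) + (x1 + 2 * x2) * 1 + 0) +
  (x2 * (t * t) + (x1 + 2 * x2) * t + (x0 + x1 + 2 * x2)) *
  (expR (- t) * -1) = - (expR (- t) * p t)).
by rewrite /p /quad; ring.
Qed.

Let G_cvg : G t @[t --> +oo%R] --> (0 : R).
Proof.
(* For t >= 1 the polynomial q is at most (x0 + 2 x1 + 5 x2) t^2, and exp t
   >= t^3 / 6; hence G t <= C / t. *)
pose C : R := 6 * (x0 + 2 * x1 + 5 * x2).
have C0 : 0 <= C by rewrite /C !(mulr_ge0, addr_ge0).
have cinv : (C * t^-1) @[t --> +oo%R] --> (0 : R).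
  rewrite -[X in _ --> X](mulr0 C); apply: cvgMr.
  by apply/gtr0_cvgV0; [exact: nbhs_pinfty_gt|exact: cvg_id].
apply: (squeeze_cvgr _ (cvg_cst 0) cinv).
near=> t.
have t1 : 1 <= t by near: t; apply: nbhs_pinfty_ge.
have t0 : 0 < t by apply: lt_le_trans t1.
have q0 : 0 <= q t.
  by rewrite /q !addr_ge0// !mulr_ge0// ?addr_ge0// ?mulr_ge0// ?exprn_ge0// ltW.
apply/andP; split; first by rewrite mulr_ge0// expR_ge0.
rewrite /G expRN mulrC ler_pdivrMr ?expR_gt0//.
have e3 : t ^+ 3 / 6 <= expR t.
  by have := expR_ge1Dxn 2 (ltW t0); rewrite (_ : 3`! = 6%N)//; lra.
apply: (@le_trans _ _ (C / t * (t ^+ 3 / 6))); last first.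
  by apply: ler_wpM2l => //; rewrite divr_ge0// ltW.
have -> : C / t * (t ^+ 3 / 6) = (x0 + 2 * x1 + 5 * x2) * t ^+ 2.
  by rewrite /C; field; rewrite gt_eqF.
have tt : t <= t ^+ 2 by rewrite expr2 ler_peMl// ltW.
have t2 : 1 <= t ^+ 2 by apply: le_trans tt.
have h1 : (x1 + 2 * x2) * t <= (x1 + 2 * x2) * t ^+ 2.
  by apply: ler_wpM2l => //; rewrite !(addr_ge0, mulr_ge0).
have h2 : x0 + x1 + 2 * x2 <= (x0 + x1 + 2 * x2) * t ^+ 2.
  by rewrite ler_peMr// !(addr_ge0, mulr_ge0).
by rewrite /q; lra.
Unshelve. all: by end_near. Qed.

(** The substitution t = (v - c) / b reduces this to the integrals of t^k
    exp(-t), which are k!.  The primitive is exp(-t) times an explicit quadratic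
    polynomial. *)
Lemma integral_exp_poly (b c : R) : 0 < b ->
  (\int[leb]_(v in `[c, +oo[) (expR (- ((v - c) / b)) * quad x0 x1 x2 ((v - c) / b))%:E =
  (b * (x0 + x1 + 2 * x2))%:E)%E.
Proof.
move=> b0.
pose t (v : R) := (v - c) / b.
pose F (v : R) := - b * G (t v).
have dt (v : R) : is_derive v (1 : R) t b^-1.
  apply: (is_derive_eq (is_deriveM
    (is_deriveB (is_derive_id v (1 : R)) (is_derive_cst c v (1 : R)))
    (is_derive_cst b^-1 v (1 : R)))).
  change ((v - c) * 0 + b^-1 * (1 - 0) = b^-1).
  by rewrite mulr0 add0r subr0 mulr1.
have dF (v : R) : is_derive v (1 : R) F (expR (- t v) * p (t v)).
  have dGt := is_derive1_comp (dG (t v)) (dt v).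
  apply: (is_derive_eq (is_deriveZ (- b) dGt)).
  by rewrite /GRing.scale/=; field; rewrite gt_eqF.
have tb (v : R) : c <= v -> 0 <= t v by move=> cv; rewrite divr_ge0 ?subr_ge0// ltW.
rewrite (@ge0_continuous_FTC2y _ (fun v => expR (- t v) * p (t v)) F c 0) //.
- rewrite sub0e -EFinN; congr EFin.
  by rewrite /F /t subrr mul0r /G /q oppr0 expR0; ring.
- move=> v cv; rewrite mulr_ge0 ?expR_ge0// /p /quad.
  by rewrite !addr_ge0// mulr_ge0// ?tb// exprn_ge0// tb.
- apply: derivable_within_continuous => v _.
  have dp := is_deriveD (is_deriveD (is_derive_cst x0 v (1 : R)) (is_deriveZ x1 (dt v)))
    (is_deriveZ x2 (is_deriveM (dt v) (dt v))).
  have de := @is_derive1_comp R expR (- t) v _ _ (is_derive_expR _) (is_deriveN (dt v)).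
  by case: (is_deriveM de dp).
- rewrite -(mulr0 (- b)); apply: cvgMr.
  apply: (@cvg_comp _ _ _ t G _ (pinfty_nbhs R)); last exact: G_cvg.
  apply/cvgryPge => A; near=> v; rewrite /t ler_pdivlMr// lerBrDr.
  by near: v; apply: nbhs_pinfty_ge; rewrite num_real.
- apply: cvg_at_right_filter.
  by apply/differentiable_continuous/derivable1_diffP; case: (dF c).
- by move=> v _; rewrite derive1E; case: (dF v).
Unshelve. all: by end_near. Qed.

End exp_poly.

Local Notation hl := halfline_measure.

Lemma integral_halfline (c : R) (f : R -> \bar R) : 0 <= c ->
  (forall v, v <= c -> f v = 0%E) ->
  (\int[hl]_v f v = \int[leb]_(v in `]c, +oo[) f v)%E.
Proof.
move=> c0 f0.
transitivity (\int[hl]_(v in `]c, +oo[) f v)%E.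
  rewrite [RHS]integral_mkcond; apply: eq_integral => v _.
  rewrite patchE; case: ifPn => //; rewrite notin_setE /= in_itv/= andbT => /negP.
  by rewrite -leNgt => /f0.
apply: eq_measure_integral => A mA Ac.
transitivity (leb (A `&` `[0%R, +oo[)) => //; rewrite setIidl// => v /Ac.
by rewrite /= !in_itv/= !andbT => /ltW; exact: le_trans.
Qed.

Lemma halfline_finite_set (A : set R) : finite_set A -> hl A = 0%E.
Proof.
move=> fA; apply/eqP; rewrite eq_le measure_ge0 andbT.
rewrite -(countable_lebesgue_measure0 (finite_set_countable fA)).
apply: le_measure; rewrite ?inE//.
- by apply: measurableI => //; exact: countable_measurable (finite_set_countable fA).
- exact: countable_measurable (finite_set_countable fA).
Qed.

Section discard.
Variable u : R -> bool.
Hypothesis fu : finite_set [set v | u v].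

Lemma measurable_discard : measurable_fun [set: R] u.
Proof.
apply: (measurable_fun_bool true); rewrite setTI.
exact: countable_measurable (finite_set_countable fu).
Qed.

Lemma halfline_below (c : R) : 0 <= c ->
  hl [set v | (v <= c) && ~~ u v] = c%:E.
Proof.
move=> c0.
have mU : measurable [set v | u v].
  exact: countable_measurable (finite_set_countable fu).
have -> : [set v | (v <= c) && ~~ u v] = `]-oo, c] `\` [set v | u v].
  by apply/seteqP; split => v /=; rewrite in_itv/=; [move=> /andP[-> /negP]|move=> [-> /negP]].
have hlc : hl `]-oo, c] = c%:E.
  transitivity (leb (`]-oo, c] `&` `[0%R, +oo[)) => //.
  rewrite (_ : _ `&` _ = `[0, c]%classic).
    rewrite lebesgue_measure_itv/= lte_fin; move: c0; rewrite le_eqVlt.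
    by move=> /predU1P[<-|c1]; rewrite ?ltxx// c1 -EFinB subr0.
  apply/seteqP; split => v /=; rewrite !in_itv/= ?andbT.
    by move=> [-> ->].
  by move=> /andP[-> ->].
rewrite measureD//=.
- rewrite -[RHS]hlc [X in (_ - X)%E](_ : _ = 0%E) ?sube0//.
  by apply: halfline_finite_set; exact: sub_finite_set (@subIsetr _ _ _) fu.
- by rewrite [ltLHS]hlc ltry.
Qed.

Section exp_quad.
Variables (b c x0 x1 x2 : R).
Hypotheses (b0 : 0 < b) (c0 : 0 <= c) (x00 : 0 <= x0) (x10 : 0 <= x1) (x20 : 0 <= x2).

(** The integrand over the height v of the new point, where c is G and b is the
    transition density at its position, so that (v - c) / b is the increment xi;
    [u] marks the used heights. *)
Definition exp_quad (v : R) : \bar R :=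
  if ~~ u v && (c < v) then
    (expR (- ((v - c) / b)) * quad x0 x1 x2 ((v - c) / b))%:E else 0%E.

Let f (v : R) : R := expR (- ((v - c) / b)) * quad x0 x1 x2 ((v - c) / b).

Let mf : measurable_fun [set: R] f.
Proof.
have mt : measurable_fun [set: R] (fun v => (v - c) / b).
  by apply: measurable_funM => //; apply: measurable_funB.
apply: measurable_funM.
  apply: (measurableT_comp (@measurable_expR R)); exact: measurable_funN.
apply: measurable_funD; first by apply: measurable_funD => //; exact: measurable_funM.
by apply: measurable_funM => //; exact: measurable_funX.
Qed.

Let f0 v : c <= v -> (0 <= (f v)%:E)%E.
Proof.
move=> cv; have t0 : 0 <= (v - c) / b by rewrite divr_ge0 ?subr_ge0// ltW.
rewrite lee_fin /f mulr_ge0 ?expR_ge0//; move: t0; move: (_ / b) => t t0.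
by rewrite /quad !addr_ge0// mulr_ge0// exprn_ge0.
Qed.

Let mlt : measurable_fun [set: R] (fun v => c < v).
Proof. exact: measurable_fun_ltr. Qed.

Lemma measurable_exp_quad : measurable_fun [set: R] exp_quad.
Proof.
apply: measurable_fun_ifT => //; last exact/measurable_EFinP.
by apply: measurable_and => //; apply: measurable_neg; exact: measurable_discard.
Qed.

Lemma exp_quad_ge0 v : (0 <= exp_quad v)%E.
Proof. by rewrite /exp_quad; case: ifP => // /andP[_ /ltW /f0]. Qed.

Lemma integral_exp_quad :
  (\int[hl]_v exp_quad v = (b * (x0 + x1 + 2 * x2))%:E)%E.
Proof.
rewrite -(integral_exp_poly x00 x10 x20 c b0).
rewrite -[RHS]integral_itv_obnd_cbnd; last first.
  by apply/measurable_EFinP; apply: measurable_funTS.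
transitivity (\int[hl]_v (if (c < v)%R then (f v)%:E else 0))%E.
  apply: ge0_ae_eq_integral => //.
  - exact: measurable_exp_quad.
  - by apply: measurable_fun_ifT => //; exact/measurable_EFinP.
  - by move=> v _; exact: exp_quad_ge0.
  - by move=> v _; case: ifP => // /ltW /f0.
  - exists [set v | u v]; split.
    + exact: countable_measurable (finite_set_countable fu).
    + exact: halfline_finite_set.
    + move=> v /= /not_implyP[_ h]; apply/negPn/negP => /negbTE uv.
      by apply: h; rewrite /exp_quad uv.
rewrite (integral_halfline c0) => [|v].
  by apply: eq_integral => v; rewrite inE/= in_itv/= andbT => ->.
by rewrite leNgt => /negbTE ->.
Qed.

End exp_quad.

End discard.
End halfline.

(** * Expectation of one level of the chain sum *)

Section ground_measure.
Local Open Scope ereal_scope.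
Context (d : measure_display) (S : measurableType d) (R : realType).
Variable mu : {sigma_finite_measure set S -> \bar R}.

(** The intensity of the process, with the half-line carried by the second
    factor: iterated integrals then run over nonnegative heights, and
    sigma-finiteness is inherited from the factors. *)
Definition ground_measure : set (S * measurableTypeR R) -> \bar R :=
  mu \x (@halfline_measure R).

HB.instance Definition _ := Measure.on ground_measure.

Lemma sigma_finite_ground_measure : sigma_finite setT ground_measure.
Proof.
have /sigma_finiteP[F [TF ndF Foo]] := sigma_finiteT mu.
have /sigma_finiteP[G [TG ndG Goo]] := sigma_finiteT (@halfline_measure R).
exists (fun n => F n `*` G n).
  rewrite -setXTT TF TG; apply/seteqP; split => [[x v] [[i _ Fx] [j _ Gv]]|[x v] [n _ [Fx Gv]]].
    exists (maxn i j) => //; split.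
    - by have /subsetPset := ndF _ _ (leq_maxl i j); exact.
    - by have /subsetPset := ndG _ _ (leq_maxr i j); exact.
  by split; exists n.
move=> k; have [mF Fk] := Foo k; have [mG Gk] := Goo k.
split; first exact: measurableX.
by rewrite /ground_measure product_measure1E// lte_mul_pinfty// ge0_fin_numE.
Qed.

HB.instance Definition _ := Measure_isSigmaFinite.Build _ _ _ ground_measure
  sigma_finite_ground_measure.

Lemma integral_ground_measure (f : S * measurableTypeR R -> \bar R) :
  (forall z, 0 <= f z) -> measurable_fun setT f ->
  \int[ground_measure]_z f z = \int[mu]_y \int[@halfline_measure R]_v f (y, v).
Proof. by move=> f0 mf; rewrite /ground_measure fubini_tonelli1. Qed.

End ground_measure.

Section expectation.
Local Open Scope ereal_scope.
Context (d : measure_display) (R : realType) (S : measurableCompleteMetricType d R).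
Local Notation X := (S * measurableTypeR R)%type.
Variable Y : exhaustion X.
Variables (g : S -> S -> R) (y0 : S) (D : set S) (h : R -> R).
Hypothesis g_measurable : measurable_fun [set: S * S] (fun p : S * S => g p.1 p.2).
Hypothesis g_ge0 : forall y y', (0 <= g y y')%R.
Hypothesis mD : measurable D.
Hypothesis mh : measurable_fun [set: R] h.
Hypothesis h_ge0 : forall a, (0 <= h a)%R.
Variable mu : {sigma_finite_measure set S -> \bar R}.
Hypothesis g_density : forall y, \int[mu]_y' (g y y')%:E = 1.
Context (dO : measure_display) (Omega : measurableType dO) (Q : probability Omega R).
Let nu : {sigma_finite_measure set X -> \bar R} := ground_measure mu.
Variable N : Omega -> config R Y.
Hypothesis pN : poisson_law Q nu N.
Let mN := poisson_law_measurable pN.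

Local Notation final_term := (@final_term d R S Y y0 h).
Local Notation step_term := (@step_term d R S Y g y0 D h).
Local Notation chain_sum := (@chain_sum d R S Y g y0 D h).
Local Notation slt_next := (slt_next g).
Local Notation reachable := (reachable g).

(** The states met along a chain with positive increments; the integral of G is
    the mean number of points under its graph. *)
Record nice (s : slt_state S) : Prop := Nice {
  nice_measurable : measurable_fun [set: S] (slt_G s);
  nice_ge0 : forall y, (0 <= slt_G s y)%R;
  nice_integrable : \int[mu]_y (slt_G s y)%:E < +oo;
  nice_finite : finite_set (slt_used s) }.

Definition area (s : slt_state S) : R := fine (\int[mu]_y (slt_G s y)%:E).

Lemma used_height_finite s : nice s -> finite_set [set v | used_height s v].
Proof.
move=> ns; apply: sub_finite_set (finite_image snd (nice_finite ns)).
by move=> v /asboolP[q sq <-]; exists q.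
Qed.

Lemma nice_measurable_state s (dT : measure_display) (T : measurableType dT) :
  nice s -> measurable_state (fun _ : T => s).
Proof.
move=> ns; split.
- exact: measurable_cst.
- by apply: (measurableT_comp (nice_measurable ns)); exact: measurable_snd.
- have := measurable_discard (used_height_finite ns) => mu_.
  by apply: (measurableT_comp mu_); exact: measurable_snd.
Qed.

Lemma nice_areaE s : nice s -> (area s)%:E = \int[mu]_y (slt_G s y)%:E.
Proof.
move=> ns; rewrite /area fineK// ge0_fin_numE ?nice_integrable//.
by apply: integral_ge0 => y _; rewrite lee_fin (nice_ge0 ns).
Qed.

Lemma rise_ge0 s p : reachable s p -> (0 <= rise g s p)%R.
Proof. by move=> /and3P[_ g0 Gp]; rewrite divr_ge0 ?subr_ge0 ?ltW. Qed.

Lemma measurable_density y : measurable_fun [set: S] (g y).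
Proof. exact: (measurableT_comp g_measurable (measurable_pair1 y)). Qed.

(** The transition density integrates to 1, so an increment xi of the level adds
    exactly xi to the area under the graph. *)
Lemma nice_next s p : nice s -> reachable s p ->
  nice (slt_next s p) /\ area (slt_next s p) = (area s + rise g s p)%R.
Proof.
move=> ns sp; have r0 := rise_ge0 sp.
have mG := nice_measurable ns.
have mg := measurable_density (slt_z s).
have intE : \int[mu]_y (slt_G (slt_next s p) y)%:E = (area s + rise g s p)%:E.
  have mge : measurable_fun [set: S] (fun y => (g (slt_z s) y)%:E).
    exact/measurable_EFinP.
  transitivity (\int[mu]_y ((slt_G s y)%:E + (rise g s p)%:E * (g (slt_z s) y)%:E)).
    by apply: eq_integral => y _; rewrite EFinD EFinM.
  rewrite ge0_integralD//=.
  + rewrite ge0_integralZl_EFin//; last by move=> y _; rewrite lee_fin.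
    by rewrite g_density mule1 -nice_areaE.
  + by move=> y _; rewrite lee_fin (nice_ge0 ns).
  + exact/measurable_EFinP.
  + by move=> y _; rewrite -EFinM lee_fin mulr_ge0.
  + exact: measurable_funeM.
split; last by rewrite /area intE.
split => /=.
- by apply: measurable_funD => //; exact: measurable_funM.
- by move=> y; apply: addr_ge0; [exact: nice_ge0|exact: mulr_ge0].
- by rewrite [ltLHS]intE ltry.
- by rewrite finite_setU; split => //; exact: nice_finite ns.
Qed.

Lemma measurable_below s : nice s -> measurable (below s).
Proof.
move=> ns; apply: measurable_set_bool; apply: measurable_and.
  apply: measurable_fun_ler; first exact: measurable_snd.
  by apply: (measurableT_comp (nice_measurable ns)); exact: measurable_fst.
apply: measurable_neg.
apply: (measurableT_comp (measurable_discard (used_height_finite ns))).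
exact: measurable_snd.
Qed.

Lemma nu_below s : nice s -> nu (below s) = (area s)%:E.
Proof.
move=> ns; rewrite nice_areaE//; apply: eq_integral => y _.
rewrite -(halfline_below (used_height_finite ns) (nice_ge0 ns y)).
congr (halfline_measure _); apply/seteqP; split => v; first by move=> /xsectionP.
by move=> vs; apply/xsectionP.
Qed.

(** The void probability of the region under the graph, whose intensity is the
    area because the finitely many used heights are negligible. *)
Lemma expectation_final s : nice s ->
  \int[Q]_w final_term s (N w) =
  (expR (- area s))%:E * (h (slt_G s y0))%:E.
Proof.
move=> ns; have mb := measurable_below ns.
have mF : measurable [set w | N w (below s) = 0].
  have := measurable_eval mN mb; move=> /(_ measurableT _ (emeasurable_set1 0)).
  by rewrite setTI.
have := poisson_law_void pN mb; rewrite nu_below// ltry => /(_ isT) /= <-.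
rewrite muleC -[in RHS](setIT [set w | _]) -(integral_indic Q measurableT mF).
rewrite -ge0_integralZl_EFin//; last exact/measurable_EFinP/measurable_indic.
Qed.

(** Mecke's formula for a functional that depends on the point only. *)
Lemma campbell A : measurable A -> \int[Q]_w N w A = nu A.
Proof.
move=> mA; pose F (z : X * config R Y) : \bar R := (\1_A z.1)%:E.
have mF : measurable_fun [set: X * config R Y] F.
  apply/measurable_EFinP.
  have mi : measurable_fun [set: X] (\1_A : X -> R) by exact: measurable_indic.
  by apply: (measurableT_comp mi); exact: measurable_fst.
have F0 z : 0 <= F z by rewrite lee_fin.
have := mecke pN F0 mF.
rewrite (eq_integral (fun w => N w A)); last first.
  by move=> w _; rewrite /F/= integral_indic// setIT.
move=> ->; rewrite -[RHS]mule1 -(@probability_setT _ _ _ Q) -integral_cst//.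
by apply: eq_integral => w _; rewrite /F /= integral_indic// setIT.
Qed.

Lemma nu_strip v : nu (@strip _ _ S v) = 0.
Proof.
apply: integral0_eq => y _.
rewrite -(halfline_finite_set (finite_set1 v)); congr (halfline_measure _).
by apply/seteqP; split => u; [move=> /xsectionP/eqP|move=> ->; apply/xsectionP/eqP].
Qed.

Lemma measurable_strip v : measurable (@strip _ _ S v).
Proof.
apply: measurable_set_bool; apply: measurable_fun_eqr => //.
Qed.

(** A horizontal line has intensity zero. *)
Lemma strip_empty v : {ae Q, forall w, N w (@strip _ _ S v) = 0}.
Proof.
have mE := measurable_eval mN (measurable_strip v).
have : \int[Q]_w `|N w (@strip _ _ S v)| = 0.
  under eq_integral do rewrite gee0_abs//.
  by rewrite campbell ?nu_strip//; exact: measurable_strip.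
move=> /(ae_eq_integral_abs _ measurableT mE) [A [mA A0 sub]].
by exists A; split => // w nw; apply: sub => /= nw'; apply: nw; exact: nw'.
Qed.

(** Every occurrence of a point in the functional is guarded by the condition
    that its height is unused; hence a point at a used height is invisible.
    This removes the point added by Mecke's formula. *)
Lemma chain_sum_add_point n s m (q : X) : nice s -> used_height s q.2 ->
  chain_sum n s (add_point m q) = chain_sum n s m.
Proof.
have belowq s' : used_height s' q.2 -> add_point m q (below s') = m (below s').
  move=> sq; rewrite add_pointE memNset ?adde0// /below /=.
  by rewrite sq andbF.
have finalq s' : used_height s' q.2 ->
    final_term s' (add_point m q) = final_term s' m.
  by move=> sq; rewrite /final_term belowq.
elim: n s => [|n ih] s ns sq /=; first exact: finalq.
have next_used p : used_height (slt_next s p) q.2.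
  by move: sq => /asboolP[q' sq' ?]; apply/asboolP; exists q' => //; right.
have mst m' : measurable_fun [set: X] (step_term (chain_sum n) s m').
  have := measurable_step_term (Y := Y) y0 g_measurable mD mh h_ge0 n
    (nice_measurable_state unit ns).
  move=> H; exact: (measurableT_comp H (measurable_pair1 (tt, m'))).
have st0 m' p : 0 <= step_term (chain_sum n) s m' p.
  by apply: step_term_ge0 => // *; exact: chain_sum_ge0.
rewrite [LHS](@ge0_integral_measure_add _ _ _ m (\d_q) setT measurableT)//.
rewrite integral_dirac// [X in _ + _ * X](_ : _ = 0); last first.
  by rewrite /step_term /admits /reachable sq/= mul0e.
rewrite mule0 adde0; apply: eq_integral => p _.
rewrite /step_term /admits; case: ifP => [sp|_]; last by rewrite !mul0e.
have [nsp _] := nice_next ns sp.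
rewrite finalq// ih//; congr ((\1__ _)%:E * _).
rewrite add_pointE memNset ?adde0// /strip /=.
by move: sp => /and3P[/negP sp _ _] /eqP qp; apply: sp; rewrite -qp.
Qed.

End expectation.

(** * The moment recursions *)

Section moments.
Local Open Scope ereal_scope.
Context (d : measure_display) (R : realType) (S : measurableCompleteMetricType d R).
Local Notation X := (S * measurableTypeR R)%type.
Variable Y : exhaustion X.
Variables (g : S -> S -> R) (y0 : S) (D : set S) (h : R -> R).
Hypothesis g_measurable : measurable_fun [set: S * S] (fun p : S * S => g p.1 p.2).
Hypothesis g_ge0 : forall y y', (0 <= g y y')%R.
Hypothesis mD : measurable D.
Hypothesis mh : measurable_fun [set: R] h.
Hypothesis h_ge0 : forall a, (0 <= h a)%R.
Variable mu : {sigma_finite_measure set S -> \bar R}.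
Hypothesis g_density : forall y, \int[mu]_y' (g y y')%:E = 1.
Context (dO : measure_display) (Omega : measurableType dO) (Q : probability Omega R).
Let nu : {sigma_finite_measure set X -> \bar R} := ground_measure mu.
Variable N : Omega -> config R Y.
Hypothesis pN : poisson_law Q nu N.
Let mN := poisson_law_measurable pN.

Variables c0 c1 c2 : R.
Hypotheses (c0_ge0 : (0 <= c0)%R) (c1_ge0 : (0 <= c1)%R) (c2_ge0 : (0 <= c2)%R).
Hypothesis h_quad : forall a, (0 <= a)%R -> h a = quad c0 c1 c2 a.

Local Notation final_term := (@final_term d R S Y y0 h).
Local Notation step_term := (@step_term d R S Y g y0 D h).
Local Notation chain_sum := (@chain_sum d R S Y g y0 D h).
Local Notation slt_next := (slt_next g).
Local Notation reachable := (reachable g).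
Local Notation rise := (rise g).
Local Notation nice := (nice mu).
Local Notation area := (area mu).

Definition survive (f : S -> \bar R) (y : S) : \bar R := if y \in D then 0 else f y.

(** The transition operator of the chain killed on D. *)
Definition transfer (f : S -> \bar R) (x : S) : \bar R :=
  \int[mu]_y ((g x y)%:E * survive f y).

Fixpoint mean (n : nat) (x : S) : \bar R :=
  if n is n'.+1 then (g x y0)%:E + transfer (mean n') x else 0.

(** The factor 2 is the second moment of a standard exponential variable. *)
Fixpoint second (n : nat) (x : S) : \bar R :=
  if n is n'.+1 then
    (2 * g x y0 ^+ 2)%:E + (2 * g x y0)%:E * transfer (mean n') x
    + transfer (second n') x
  else 0.

(** With first two moments m and s of the remaining increment X, this is the
    mean of h(a + X), for h the polynomial c0 + c1 t + c2 t^2. *)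
Definition moment (m s : S -> \bar R) (x : S) (a : R) : \bar R :=
  (quad c0 c1 c2 a)%:E + (c1 + 2 * c2 * a)%:E * m x + c2%:E * s x.

Lemma survive_ge0 f : (forall y, 0 <= f y) -> forall y, 0 <= survive f y.
Proof. by move=> f0 y; rewrite /survive; case: ifP. Qed.

Lemma transfer_ge0 f : (forall y, 0 <= f y) -> forall x, 0 <= transfer f x.
Proof.
move=> f0 x; apply: integral_ge0 => y _.
by rewrite mule_ge0 ?lee_fin// survive_ge0.
Qed.

Lemma mean_ge0 n x : 0 <= mean n x.
Proof.
elim: n x => [//|n ih] x /=.
by rewrite adde_ge0 ?lee_fin//; exact: transfer_ge0.
Qed.

Lemma second_ge0 n x : 0 <= second n x.
Proof.
elim: n x => [//|n ih] x /=; rewrite adde_ge0//; last exact: transfer_ge0.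
rewrite adde_ge0 ?lee_fin ?mulr_ge0 ?exprn_ge0// mule_ge0 ?lee_fin ?mulr_ge0//.
by apply: transfer_ge0; exact: mean_ge0.
Qed.

Lemma measurable_survive f : measurable_fun [set: S] f ->
  measurable_fun [set: S] (survive f).
Proof.
move=> mf; apply: measurable_fun_ifT => //.
apply: (measurable_fun_bool true); rewrite setTI.
by rewrite (_ : _ @^-1` _ = D)//; apply/seteqP; split => y /=; [exact: set_mem|exact: mem_set].
Qed.

Lemma measurable_transfer f : (forall y, 0 <= f y) -> measurable_fun [set: S] f ->
  measurable_fun [set: S] (transfer f).
Proof.
move=> f0 mf.
apply: (@measurable_fun_fubini_tonelli_F _ _ _ _ _ mu
  (fun z : S * S => (g z.1 z.2)%:E * survive f z.2)).
  apply: emeasurable_funM; first exact/measurable_EFinP.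
  by apply: (measurableT_comp (measurable_survive mf)); exact: measurable_snd.
by move=> z; rewrite mule_ge0 ?lee_fin// survive_ge0.
Qed.

Let mg0 : measurable_fun [set: S] (fun x => g x y0).
Proof. exact: (measurableT_comp g_measurable (measurable_pair2 y0)). Qed.

Lemma measurable_mean n : measurable_fun [set: S] (mean n).
Proof.
elim: n => [|n ih] /=; first exact: measurable_cst.
apply: emeasurable_funD; first exact/measurable_EFinP.
by apply: measurable_transfer => //; exact: mean_ge0.
Qed.

Lemma measurable_second n : measurable_fun [set: S] (second n).
Proof.
elim: n => [|n ih] /=; first exact: measurable_cst.
have mK : measurable_fun [set: S] (transfer (mean n)).
  by apply: measurable_transfer; [exact: mean_ge0|exact: measurable_mean].
apply: emeasurable_funD; last by apply: measurable_transfer => //; exact: second_ge0.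
apply: emeasurable_funD.
  by apply/measurable_EFinP; apply: measurable_funM => //; exact: measurable_funX.
by apply: emeasurable_funM => //; apply/measurable_EFinP; exact: measurable_funM.
Qed.

(** Mecke's formula trades the point p of the configuration for a point
    distributed according to the intensity; the strip at its height is then
    almost surely occupied by p alone, and p is invisible to the rest of the
    functional. *)
Lemma expectation_step n (s : slt_state S) (M : S -> R -> \bar R) :
  nice s ->
  (forall s', nice s' -> \int[Q]_w chain_sum n s' (N w) =
     (expR (- area s'))%:E * M (slt_z s') (slt_G s' y0)) ->
  \int[Q]_w chain_sum n.+1 s (N w) =
  \int[nu]_p (if reachable s p then
      (expR (- (area s + rise s p)))%:E *
      (if p.1 \in D then (h (slt_G s y0 + rise s p * g (slt_z s) y0))%:E
       else M p.1 (slt_G s y0 + rise s p * g (slt_z s) y0)%R)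
    else 0).
Proof.
move=> ns ih.
have mst := measurable_step_term (Y := Y) y0 g_measurable mD mh h_ge0 n
    (nice_measurable_state unit ns).
pose F (z : X * config R Y) := step_term (chain_sum n) s z.2 z.1.
have mF : measurable_fun [set: X * config R Y] F.
  have msw : measurable_fun [set: X * config R Y] (fun z => ((tt, z.2), z.1)).
    apply: measurable_fun_pair; last exact: measurable_fst.
    by apply: measurable_fun_pair => //; exact: measurable_snd.
  exact: (measurableT_comp mst msw).
have F0 z : 0 <= F z by apply: step_term_ge0 => // *; exact: chain_sum_ge0.
transitivity (\int[Q]_w \int[nu]_p F (p, add_point (N w) p)).
  by rewrite -(mecke pN F0 mF).
have mFa : measurable_fun [set: Omega * X] (fun z => F (z.2, add_point (N z.1) z.2)).
  apply: (measurableT_comp mF); apply: measurable_fun_pair.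
    exact: measurable_snd.
  exact: measurable_add_point pN.
rewrite -(@fubini_tonelli1 _ _ _ _ _ Q nu (fun z => F (z.2, add_point (N z.1) z.2)))//.
rewrite (@fubini_tonelli2 _ _ _ _ _ Q nu)//.
apply: eq_integral => p _; rewrite /fubini_G /= /F /step_term /admits /=.
case: ifP => sp; last by apply: integral0_eq => w _; rewrite mul0e.
have [nsp areaE] := nice_next g_measurable g_ge0 g_density ns sp.
pose K m := if p.1 \in D then final_term (slt_next s p) m
            else chain_sum n (slt_next s p) m.
have pK m : (if p.1 \in D then final_term (slt_next s p) (add_point m p)
            else chain_sum n (slt_next s p) (add_point m p)) = K m.
  have used_p : used_height (slt_next s p) p.2 by apply/asboolP; exists p => //; left.
  rewrite /K; case: ifP => _; last first.
    exact: (chain_sum_add_point y0 g_measurable g_ge0 mD mh h_ge0 g_density n m nsp used_p).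
  exact: (chain_sum_add_point (D := D) y0 g_measurable g_ge0 mD mh h_ge0 g_density 0).
have mK : measurable_fun [set: Omega] (fun w => K (N w)).
  have mu1 := nice_measurable_state unit nsp.
  have mN' : measurable_fun [set: Omega] (fun w => (tt, N w)).
    by apply: measurable_fun_pair => //; exact: poisson_law_measurable pN.
  rewrite /K; case: (p.1 \in D).
    exact: (measurableT_comp (measurable_final_term (Y := Y) y0 mh mu1) mN').
  exact: (measurableT_comp (measurable_chain_sum (Y := Y) y0 g_measurable mD mh h_ge0 n mu1) mN').
have K0 m : 0 <= K m.
  by rewrite /K; case: ifP => _; [exact: final_term_ge0|exact: chain_sum_ge0].
transitivity (\int[Q]_w K (N w)).
  have [B [mB B0 NB]] := strip_empty pN p.2.
  apply: ge0_ae_eq_integral => //.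
  - have := measurableT_comp mFa (measurable_pair2 p).
    by rewrite /comp /F /step_term /admits /= sp.
  - by move=> w _; rewrite mule_ge0 ?lee_fin// pK.
  - exists B; split => // w nw; apply: NB => /= Nw; apply: nw => _.
    rewrite pK (_ : add_point _ _ _ = 1%:E).
      by rewrite indicE mem_set// mul1e.
    by rewrite add_pointE Nw add0e mem_set// /strip/=.
rewrite /K; case: ifP => _.
  by rewrite (expectation_final y0 h_ge0 pN nsp) areaE.
by rewrite ih// areaE.
Qed.

(** For a fixed position y of the new point, the height integral is an integral
    over t = xi against exp(-t), with Jacobian g; the moment of the new state is
    a polynomial of degree 2 in t. *)
Lemma integral_heights (s : slt_state S) (k a : R) (m1 m2 : \bar R) y :
  nice s -> (0 <= a)%R -> 0 <= m1 -> 0 <= m2 ->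
  let b := g (slt_z s) y0 in
  \int[@halfline_measure R]_v
    (if reachable s (y, v) then
       (expR (- (k + rise s (y, v))))%:E *
       ((quad c0 c1 c2 (a + rise s (y, v) * b))%:E +
        (c1 + 2 * c2 * (a + rise s (y, v) * b))%:E * m1 + c2%:E * m2)
     else 0) =
  (expR (- k))%:E * (g (slt_z s) y)%:E *
  ((quad c0 c1 c2 a + c1 * b + 2 * c2 * a * b + 2 * (c2 * b ^+ 2))%:E +
   (c1 + 2 * c2 * a + 2 * c2 * b)%:E * m1 + c2%:E * m2).
Proof.
move=> ns a0 m10 m20 b.
have b0 : (0 <= b)%R by exact: g_ge0.
have fu := used_height_finite ns.
have G0 := nice_ge0 ns y.
have [gy|gy] := eqVneq (g (slt_z s) y) 0%R.
  rewrite gy mule0 mul0e; apply: integral0_eq => v _.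
  by rewrite /reachable /= gy ltxx andbF.
have {gy} gy : (0 < g (slt_z s) y)%R by rewrite lt_neqAle eq_sym gy g_ge0.
(* Expansion in powers of t = xi: E0, E1 and E2 are the parts free of
   moments, proportional to m1 and proportional to m2. *)
pose E x0 x1 x2 : R -> \bar R :=
  exp_quad (used_height s) (g (slt_z s) y) (slt_G s y) x0 x1 x2.
pose E0 := E (quad c0 c1 c2 a) (c1 * b + 2 * c2 * a * b)%R (c2 * b ^+ 2)%R.
pose E1 := E (c1 + 2 * c2 * a)%R (2 * c2 * b)%R 0%R.
pose E2 := E c2 0%R 0%R.
have q0 : (0 <= quad c0 c1 c2 a)%R by rewrite /quad !addr_ge0// mulr_ge0// exprn_ge0.
have cab : (0 <= c1 * b + 2 * c2 * a * b)%R.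
  by rewrite addr_ge0 ?mulr_ge0// ?mulr_ge0// mulr_ge0.
have cb2 : (0 <= c2 * b ^+ 2)%R by rewrite mulr_ge0// exprn_ge0.
have ca : (0 <= c1 + 2 * c2 * a)%R by rewrite addr_ge0 ?mulr_ge0// mulr_ge0.
have cb : (0 <= 2 * c2 * b)%R by rewrite mulr_ge0// mulr_ge0.
have E00 v : 0 <= E0 v by exact: exp_quad_ge0.
have E10 v : 0 <= E1 v by exact: exp_quad_ge0.
have E20 v : 0 <= E2 v by exact: exp_quad_ge0.
have mE x0 x1 x2 : measurable_fun [set: R] (E x0 x1 x2) by exact: measurable_exp_quad.
transitivity (\int[@halfline_measure R]_v
    ((expR (- k))%:E * (E0 v + E1 v * m1 + E2 v * m2))).
  apply: eq_integral => v _; rewrite /E0 /E1 /E2 /E /exp_quad /reachable /= gy /=.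
  case: ifP => [/andP[_ Gv]|_]; last by rewrite !mul0e !adde0 mule0.
  rewrite /rise /=; set t := ((v - _) / _)%R.
  have t0 : (0 <= t)%R by rewrite divr_ge0 ?subr_ge0 ?ltW.
  have et0 : (0 <= expR (- t))%R := expR_ge0 _.
  rewrite opprD expRD EFinM -muleA; congr (_ * _).
  rewrite ge0_muleDr; last 2 first.
  - rewrite adde_ge0 ?lee_fin ?mule_ge0 ?lee_fin//.
      by rewrite /quad !addr_ge0// ?mulr_ge0// ?exprn_ge0// addr_ge0// mulr_ge0.
    by rewrite addr_ge0// mulr_ge0 ?mulr_ge0// addr_ge0// mulr_ge0.
  - by rewrite mule_ge0.
  rewrite ge0_muleDr; last 2 first.
  - by rewrite lee_fin /quad !addr_ge0// ?mulr_ge0// ?exprn_ge0// addr_ge0// mulr_ge0.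
  - rewrite mule_ge0// lee_fin.
    by rewrite addr_ge0// mulr_ge0 ?mulr_ge0// addr_ge0// mulr_ge0.
  rewrite !muleA -!EFinM; congr (_%:E + _%:E * _ + _%:E * _); congr (_ * _)%R;
    rewrite /quad; ring.
have mEm f m : measurable_fun [set: R] f -> measurable_fun [set: R] (fun v => f v * m).
  by move=> mf; exact: (emeasurable_funM mf (measurable_cst m)).
have mE01 : measurable_fun [set: R] (fun v => E0 v + E1 v * m1).
  by apply: emeasurable_funD; [exact: mE|apply: mEm; exact: mE].
rewrite ge0_integralZl//; last 2 first.
- by apply: emeasurable_funD => //; apply: mEm; exact: mE.
- by move=> v _; rewrite !adde_ge0// mule_ge0.
rewrite -muleA; congr (_ * _).
rewrite ge0_integralD//; last 3 first.
- by move=> v _; rewrite adde_ge0// mule_ge0.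
- by move=> v _; rewrite mule_ge0.
- by apply: mEm; exact: mE.
rewrite ge0_integralD//; last 2 first.
- by move=> v _; rewrite mule_ge0.
- by apply: mEm; exact: mE.
rewrite !ge0_integralZr//.
rewrite !integral_exp_quad// !EFinM -!muleA -!ge0_muleDr; last 4 first.
- rewrite mulr0 addr0; apply: adde_ge0.
    by rewrite lee_fin; apply: addr_ge0; [exact: addr_ge0|exact: mulr_ge0].
  by apply: mule_ge0 => //; rewrite lee_fin; exact: addr_ge0.
- by apply: mule_ge0 => //; rewrite lee_fin mulr0 !addr0.
- by rewrite lee_fin; apply: addr_ge0; [exact: addr_ge0|exact: mulr_ge0].
- by rewrite mulr0 addr0; apply: mule_ge0 => //; rewrite lee_fin; exact: addr_ge0.
- by rewrite !mulr0 !addr0 !addrA.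
- exact: mE.
- exact: mE.
- exact: mE.
Qed.

(** Integrating [integral_heights] over the position y turns the factors g(x, y)
    into the total mass 1 and the operator [transfer]. *)
Lemma integral_step (s : slt_state S) (m1 m2 : S -> \bar R) :
  nice s -> (forall y, 0 <= m1 y) -> (forall y, 0 <= m2 y) ->
  measurable_fun [set: S] m1 -> measurable_fun [set: S] m2 ->
  let b := g (slt_z s) y0 in
  \int[nu]_p (if reachable s p then
      (expR (- (area s + rise s p)))%:E *
      (if p.1 \in D then (h (slt_G s y0 + rise s p * b))%:E
       else moment m1 m2 p.1 (slt_G s y0 + rise s p * b)%R)
    else 0) =
  (expR (- area s))%:E *
  moment (fun x => (g x y0)%:E + transfer m1 x)
    (fun x => (2 * g x y0 ^+ 2)%:E + (2 * g x y0)%:E * transfer m1 x + transfer m2 x)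
    (slt_z s) (slt_G s y0).
Proof.
move=> ns m10 m20 mm1 mm2 b.
have a0 : (0 <= slt_G s y0)%R by exact: nice_ge0 ns _.
have b0 : (0 <= b)%R by exact: g_ge0.
set a := slt_G s y0 in a0 *.
have sm1 := measurable_survive mm1; have sm2 := measurable_survive mm2.
have s10 := survive_ge0 m10; have s20 := survive_ge0 m20.
pose f (p : X) := if reachable s p then
    (expR (- (area s + rise s p)))%:E *
    ((quad c0 c1 c2 (a + rise s p * b))%:E +
     (c1 + 2 * c2 * (a + rise s p * b))%:E * survive m1 p.1 + c2%:E * survive m2 p.1)
  else 0.
transitivity (\int[nu]_p f p).
  apply: eq_integral => p _; rewrite /f; case: ifP => // sp; congr (_ * _).
  have a'0 : (0 <= a + rise s p * b)%R.
    by apply: addr_ge0 => //; apply: mulr_ge0 => //; exact: rise_ge0.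
  rewrite /moment /survive; case: ifP => // _.
  by rewrite !mule0 !adde0 h_quad.
have ms := nice_measurable_state X ns.
have mid : measurable_fun [set: X] id by exact: measurable_id.
have mrise : measurable_fun [set: X] (rise s).
  exact: (measurable_rise g_measurable ms mid mid).
have ma' : measurable_fun [set: X] (fun p => (a + rise s p * b)%R).
  by apply: measurable_funD => //; apply: measurable_funM.
have mf : measurable_fun [set: X] f.
  apply: measurable_fun_ifT => //.
    exact: (measurable_reachable g_measurable ms mid mid).
  apply: emeasurable_funM.
    apply/measurable_EFinP; apply: (measurableT_comp (@measurable_expR R)).
    by apply: measurable_funN; apply: measurable_funD.
  have ms1 : measurable_fun [set: X] (fun p => survive m1 p.1).
    by apply: (measurableT_comp sm1); exact: measurable_fst.
  have ms2 : measurable_fun [set: X] (fun p => survive m2 p.1).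
    by apply: (measurableT_comp sm2); exact: measurable_fst.
  apply: emeasurable_funD; last exact: (emeasurable_funM (measurable_cst _) ms2).
  apply: emeasurable_funD.
    apply/measurable_EFinP; rewrite /quad; apply: measurable_funD.
      by apply: measurable_funD => //; exact: measurable_funM.
    by apply: measurable_funM => //; exact: measurable_funX.
  apply: emeasurable_funM => //; apply/measurable_EFinP.
  by apply: measurable_funD => //; exact: measurable_funM.
have f0 p : 0 <= f p.
  rewrite /f; case: ifP => // sp.
  have a'0 : (0 <= a + rise s p * b)%R.
    by apply: addr_ge0 => //; apply: mulr_ge0 => //; exact: rise_ge0.
  rewrite mule_ge0 ?lee_fin ?expR_ge0// !adde_ge0 ?mule_ge0 ?lee_fin//.
    by rewrite /quad !addr_ge0// mulr_ge0// exprn_ge0.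
  by rewrite addr_ge0 ?mulr_ge0// mulr_ge0.
rewrite [LHS](integral_ground_measure mu f0 mf).
rewrite /f /=; under eq_integral => y _ do rewrite integral_heights//.
rewrite -/b; set L0 := (quad c0 c1 c2 a + c1 * b + 2 * c2 * a * b + 2 * (c2 * b ^+ 2))%R.
set L1 := (c1 + 2 * c2 * a + 2 * c2 * b)%R.
have L00 : (0 <= L0)%R.
  rewrite /L0 !addr_ge0 ?mulr_ge0 ?exprn_ge0//.
have L10 : (0 <= L1)%R by rewrite /L1 !addr_ge0 ?mulr_ge0.
have mg := measurable_density g_measurable (slt_z s).
have mge : measurable_fun [set: S] (fun y => (g (slt_z s) y)%:E) by exact/measurable_EFinP.
transitivity (\int[mu]_y ((expR (- area s))%:E * (L0%:E * (g (slt_z s) y)%:E +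
    L1%:E * ((g (slt_z s) y)%:E * survive m1 y) +
    c2%:E * ((g (slt_z s) y)%:E * survive m2 y)))).
  apply: eq_integral => y _; rewrite -muleA; congr (_ * _).
  rewrite ge0_muleDr; last 2 first.
  - by rewrite adde_ge0 ?mule_ge0 ?lee_fin.
  - by rewrite mule_ge0.
  rewrite ge0_muleDr ?lee_fin ?mule_ge0//.
  by rewrite [X in X + _ + _]muleC; congr (_ + _ + _); rewrite muleCA.
have mgs k : measurable_fun [set: S] k ->
    measurable_fun [set: S] (fun y => (g (slt_z s) y)%:E * k y).
  by move=> mk; exact: emeasurable_funM.
have mcgs c k : measurable_fun [set: S] k ->
    measurable_fun [set: S] (fun y => c%:E * k y).
  by move=> mk; exact: (emeasurable_funM (measurable_cst _) mk).
have gk0 k y : (forall y, 0 <= k y) -> 0 <= (g (slt_z s) y)%:E * k y.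
  by move=> k0; rewrite mule_ge0 ?lee_fin.
rewrite ge0_integralZl//; last 2 first.
- apply: emeasurable_funD; last by apply: mcgs; exact: mgs.
  by apply: emeasurable_funD; [exact: mcgs|apply: mcgs; exact: mgs].
- by move=> y _; rewrite !adde_ge0// mule_ge0 ?lee_fin// gk0.
congr (_ * _).
rewrite ge0_integralD//; last 4 first.
- by move=> y _; rewrite adde_ge0// mule_ge0 ?lee_fin// gk0.
- by apply: emeasurable_funD; [exact: mcgs|apply: mcgs; exact: mgs].
- by move=> y _; rewrite mule_ge0 ?lee_fin// gk0.
- by apply: mcgs; exact: mgs.
rewrite ge0_integralD//; last 4 first.
- by move=> y _; rewrite mule_ge0 ?lee_fin.
- exact: mcgs.
- by move=> y _; rewrite mule_ge0 ?lee_fin// gk0.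
- by apply: mcgs; exact: mgs.
rewrite !ge0_integralZl//; last 5 first.
- exact: mgs.
- by move=> y _; exact: gk0.
- exact: mgs.
- by move=> y _; exact: gk0.
- by move=> y _; rewrite lee_fin.
rewrite g_density mule1 /moment.
have T10 := transfer_ge0 m10 (slt_z s); have T20 := transfer_ge0 m20 (slt_z s).
rewrite -/(transfer m1 (slt_z s)) -/(transfer m2 (slt_z s)) -/b.
move: (transfer m1 _) (transfer m2 _) T10 T20 => T1 T2 T10 T20.
have ca : (0 <= c1 + 2 * c2 * a)%R.
  by apply: addr_ge0 => //; rewrite mulr_ge0// mulr_ge0.
have cb : (0 <= 2 * c2 * b)%R by rewrite mulr_ge0// mulr_ge0.
have b2 : (0 <= 2 * b ^+ 2)%R by rewrite mulr_ge0// exprn_ge0.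
have -> : L1%:E * T1 = (c1 + 2 * c2 * a)%:E * T1 + (2 * c2 * b)%:E * T1.
  by rewrite /L1 [(_ + 2 * c2 * b)%:E]EFinD ge0_muleDl.
have -> : (c1 + 2 * c2 * a)%:E * (b%:E + T1) =
    ((c1 + 2 * c2 * a) * b)%:E + (c1 + 2 * c2 * a)%:E * T1.
  by rewrite ge0_muleDr// lee_fin.
have -> : c2%:E * ((2 * b ^+ 2)%:E + (2 * b)%:E * T1 + T2) =
    (c2 * (2 * b ^+ 2))%:E + (2 * c2 * b)%:E * T1 + c2%:E * T2.
  rewrite ge0_muleDr//; last by rewrite adde_ge0 ?lee_fin// mule_ge0// lee_fin mulr_ge0.
  rewrite ge0_muleDr ?lee_fin//; last by rewrite mule_ge0// lee_fin mulr_ge0.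
  by rewrite muleA -!EFinM; congr (_ + _%:E * _ + _); ring.
move: (_ * T1) ((2 * c2 * b)%:E * T1) (c2%:E * T2) => u w z.
rewrite !addeA (addeAC _ u) -!EFinD; congr (_%:E + _ + _ + _).
by rewrite /L0; ring.
Qed.

(** The factor exp(- area) is the probability that no point has been met before
    the current levels. *)
Theorem expectation_chain_sum n (s : slt_state S) : nice s ->
  \int[Q]_w chain_sum n s (N w) =
  (expR (- area s))%:E * moment (mean n) (second n) (slt_z s) (slt_G s y0).
Proof.
elim: n s => [|n ih] s ns.
  rewrite (expectation_final y0 h_ge0 pN ns) /moment /= !mule0 !adde0.
  by rewrite h_quad// (nice_ge0 ns).
rewrite (expectation_step ns ih) integral_step//.
- exact: mean_ge0.
- exact: second_ge0.
- exact: measurable_mean.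
- exact: measurable_second.
Qed.

End moments.

(** * The chain sum along a given configuration *)

Section pathwise.
Local Open Scope ereal_scope.
Context (d : measure_display) (R : realType) (S : measurableCompleteMetricType d R).
Local Notation X := (S * measurableTypeR R)%type.
Variable Y : exhaustion X.
Variables (g : S -> S -> R) (y0 : S) (D : set S).
Hypothesis g_measurable : measurable_fun [set: S * S] (fun p : S * S => g p.1 p.2).
Hypothesis g_ge0 : forall y y', (0 <= g y y')%R.
Hypothesis mD : measurable D.
Variable mu : {sigma_finite_measure set S -> \bar R}.
Hypothesis g_density : forall y, \int[mu]_y' (g y y')%:E = 1.
Hypothesis measurable_point : forall p : X, measurable [set p].
Variable m : config R Y.
Hypothesis m_atomic : forall A : set X, measurable A -> m A != 0 ->
  exists2 p, atoms m p & A p.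

Local Notation P := (atoms m).
Local Notation slt_next := (slt_next g).
Local Notation reachable := (reachable g).
Local Notation rise := (rise g).
Local Notation nice := (nice mu).

Lemma atom_ge1 p : P p -> 1 <= m [set p].
Proof.
move=> mp.
have bp : bounded_in Y [set p].
  have [j _ Yp] : (\bigcup_j Y j) p by rewrite exh_cover.
  by exists j => _ ->.
have [k mk] := config_nat m (measurable_point p) bp.
move: mp; rewrite /atoms /= mk lee_fin lte_fin ltr0n => k0.
by rewrite ler1n.
Qed.

Lemma no_atom A p : measurable A -> m A = 0 -> P p -> ~ A p.
Proof.
move=> mA mA0 /atom_ge1 p1 Ap.
have : m [set p] <= m A by apply: le_measure; rewrite ?inE// => _ ->.
by move=> /(le_trans p1); rewrite mA0 lee_fin ler10.
Qed.

Lemma single_atom A p q : measurable A -> m A = 1%:E -> P p -> P q ->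
  A p -> A q -> p = q.
Proof.
move=> mA mA1 /atom_ge1 p1 /atom_ge1 q1 Ap Aq; apply: contrapT => pq.
have : m ([set p] `|` [set q]) <= m A.
  by apply: le_measure; rewrite ?inE//; [exact: measurableU|move=> _ [->|->]].
rewrite measureU//; last by rewrite -subset0 => x [-> /= /pq].
move=> /(le_trans (leeD p1 q1)); rewrite mA1 -EFinD lee_fin.
by rewrite gerDl ler10.
Qed.

Lemma integral_neq0_atom (f : X -> \bar R) : measurable_fun setT f ->
  (forall p, 0 <= f p) -> \int[m]_p f p != 0 -> exists2 p, P p & f p != 0.
Proof.
move=> mf f0; apply: contra_neqP => nf.
have mA : measurable [set p | f p != 0].
  rewrite -[X in measurable X]setTI; exact: emeasurable_neq.
rewrite -[RHS](integral0 m setT); apply: ge0_ae_eq_integral => //.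
exists [set p | f p != 0]; split => //.
  apply/eqP/negPn/negP => /(m_atomic mA)[p Pp fp].
  by apply: nf; exists p.
by move=> p /= /not_implyP[_ /eqP].
Qed.

(** Proved through the atoms only, so that no enumeration of the configuration
    has to be extracted from the measure. *)
Lemma integral_single_atom (f : X -> \bar R) p : measurable_fun setT f ->
  (forall p, 0 <= f p) -> P p -> m [set p] = 1%:E ->
  (forall q, P q -> q <> p -> f q = 0) -> \int[m]_q f q = f p.
Proof.
move=> mf f0 Pp mp fq.
pose fp q := f p * (\1_[set p] q)%:E.
have mi : measurable_fun [set: X] (fun q => (\1_[set p] q)%:E : \bar R).
  by apply/measurable_EFinP; exact: measurable_indic.
have mfp : measurable_fun [set: X] fp by exact: measurable_funeM.
have mA : measurable [set q | f q != fp q].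
  rewrite (_ : [set q | _] = [set~ p] `&` [set q | f q != 0]).
    apply: measurableI; first exact: measurableC.
    rewrite -[X in measurable X]setTI; exact: emeasurable_neq.
  apply/seteqP; split => q /=; rewrite /fp indicE.
    have [->|qp] := pselect (q = p); first by rewrite mem_set// mule1 eqxx.
    by rewrite memNset// mule0.
  by move=> [qp]; rewrite memNset// mule0.
transitivity (\int[m]_q fp q).
  apply: ge0_ae_eq_integral => //.
    by move=> q _; rewrite mule_ge0// lee_fin.
  exists [set q | f q != fp q]; split => //.
    apply/eqP/negPn/negP => /(m_atomic mA)[q Pq /= /negP]; apply; apply/eqP.
    rewrite /fp indicE.
    have [->|qp] := pselect (q = p); first by rewrite mem_set// mule1.
    by rewrite fq// memNset// mule0.
  by move=> q /= /not_implyP[_ /eqP].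
rewrite /fp ge0_integralZl//.
by rewrite integral_indic// setIT mp mule1.
Qed.

(** For points of the configuration, discarding used heights is the same as
    discarding used points. *)
Definition consistent (s : slt_state S) :=
  forall q, P q -> used_height s q.2 -> slt_used s q.

Definition candidate (s : slt_state S) (p : X) :=
  [/\ P p, reachable s p & m (@strip d R S p.2) = 1%:E].

(** There is an admissible chain with no other point under its final graph. *)
Fixpoint valid (n : nat) (s : slt_state S) : Prop :=
  if n is n'.+1 then
    exists2 p, candidate s p &
      if p.1 \in D then m (below (slt_next s p)) = 0 else valid n' (slt_next s p)
  else m (below s) = 0.

Lemma candidate_strip s p q : candidate s p -> P q -> q.2 = p.2 -> q = p.
Proof.
move=> [Pp sp m1] Pq qp; apply: (single_atom _ m1) => //.
- exact: measurable_strip.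
- by rewrite /strip /= qp.
- by rewrite /strip /=.
Qed.

Lemma used_height_next s p v :
  used_height (slt_next s p) v = (p.2 == v :> R) || used_height s v.
Proof.
apply/idP/idP => [/asboolP[q [->|sq] <-]|/orP[/eqP <-|]].
- by rewrite eqxx.
- by apply/orP; right; apply/asboolP; exists q.
- by apply/asboolP; exists p => //; left.
- by move=> /asboolP[q sq <-]; apply/asboolP; exists q => //; right.
Qed.

(** The graphs increase, so a point missed before the step would be missed after
    it, unless it is the new point, which lies strictly above the old graph. *)
Lemma below_next s p : nice s -> candidate s p ->
  m (below (slt_next s p)) = 0 -> m (below s) = 0.
Proof.
move=> ns sp; have [Pp rp _] := sp.
have [nsp _] := nice_next g_measurable g_ge0 g_density ns rp.
move=> m0; apply/eqP/negPn/negP => /(m_atomic (measurable_below ns)) [q Pq].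
move=> /andP[qG qs].
have [qp|/eqP qp] := eqVneq (q.2 : R) p.2.
  move: rp => /and3P[_ _]; rewrite -(candidate_strip sp Pq qp).
  by rewrite ltNge qG.
apply: (no_atom (measurable_below nsp) m0 Pq); apply/andP; split.
  apply: (le_trans qG); rewrite /= lerDl mulr_ge0//; exact: rise_ge0 rp.
by rewrite used_height_next negb_or qs andbT; apply/eqP => /esym.
Qed.

Lemma valid_below n s : nice s -> valid n s -> m (below s) = 0.
Proof.
elim: n s => [//|n ih] s ns /= [p sp].
have [_ rp _] := sp.
have [nsp _] := nice_next g_measurable g_ge0 g_density ns rp.
by case: ifP => _ => [|/(ih _ nsp)]; exact: below_next.
Qed.

(** No unused point lies under the raised graph, and the points other than p on
    the graph would be missed as well; hence the infimum of the construction is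
    attained at p and nowhere else. *)
Lemma slt_stepE s p : nice s -> consistent s -> candidate s p ->
  m (below (slt_next s p)) = 0 -> slt_step g P s = slt_next s p.
Proof.
move=> ns cs sp m0; have [Pp rp _] := sp.
have /and3P[usp gp Gp] := rp.
have [nsp _] := nice_next g_measurable g_ge0 g_density ns rp.
have r0 := rise_ge0 rp.
have rpE : (slt_G s p.1 + rise s p * g (slt_z s) p.1 = p.2)%R.
  by rewrite /rise divfK ?gt_eqF// addrC subrK.
have above q : P q -> ~ slt_used s q -> q <> p ->
    (slt_G s q.1 + rise s p * g (slt_z s) q.1 < q.2)%R.
  move=> Pq uq qp; rewrite ltNge; apply/negP => qG.
  apply: (no_atom (measurable_below nsp) m0 Pq); apply/andP; split => //.
  rewrite used_height_next negb_or; apply/andP; split.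
    by apply/eqP => pq; apply: qp; exact: candidate_strip sp Pq (esym pq).
  by apply/negP => /(cs _ Pq).
have unused : ~ slt_used s p.
  by move=> up; move/negP: usp; apply; apply/asboolP; exists p.
rewrite /slt_step; set A := [set t | _].
have -> : inf A = rise s p.
  have Ar : A (rise s p) by split => //; exists p; split => //; rewrite rpE.
  apply/eqP; rewrite eq_le; apply/andP; split.
    by apply: ge_inf => //; exists 0%R => t [].
  apply: lb_le_inf; first by exists (rise s p).
  move=> t [t0 [q [Pq uq qt]]].
  have [qp|qp] := pselect (q = p).
    by rewrite /rise ler_pdivrMr// lerBlDl -[p]qp.
  rewrite leNgt; apply/negP => tr.
  have := above _ Pq uq qp; rewrite ltNge => /negP; apply.
  by apply: (le_trans qt); rewrite lerD2l ler_wpM2r// ltW.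
rewrite /slt_next; set B := [set q | _].
suff -> : get B = p by [].
apply: xget_subset1; first by split.
move=> q q' [Pq uq qE] [Pq' uq' qE'].
have Bp r : P r -> ~ slt_used s r ->
    (slt_G s r.1 + rise s p * g (slt_z s) r.1 = r.2)%R -> r = p.
  move=> Pr ur rE; apply: contrapT => rp'.
  by have := above _ Pr ur rp'; rewrite rE ltxx.
by rewrite (Bp q)// (Bp q').
Qed.

Lemma consistent_next s p : consistent s -> candidate s p -> consistent (slt_next s p).
Proof.
move=> cs sp q Pq; rewrite used_height_next => /orP[/eqP pq|/(cs _ Pq) uq].
  by left; exact: candidate_strip sp Pq (esym pq).
by right.
Qed.

Lemma slt_next_inj s p q : reachable s p -> slt_next s p = slt_next s q -> p = q.
Proof.
move=> /and3P[/negP sp _ _] /(congr1 (@slt_used _ _ _)) /= pq.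
have : (q |` slt_used s) p by rewrite -pq; left.
by case=> // sp'; exfalso; apply: sp; apply/asboolP; exists p.
Qed.

(** The construction frozen at the first entrance of the chain into D. *)
Fixpoint stopped (n : nat) (s : slt_state S) : slt_state S :=
  if n is n'.+1 then
    let s' := slt_step g P s in
    if slt_z s' \in D then s' else stopped n' s'
  else s.

Section functional_value.
Variable h : R -> R.
Hypothesis mh : measurable_fun [set: R] h.
Hypothesis h_ge0 : forall a, (0 <= h a)%R.
Local Notation final_term := (@final_term d R S Y y0 h).
Local Notation step_term := (@step_term d R S Y g y0 D h).
Local Notation chain_sum := (@chain_sum d R S Y g y0 D h).

Let mst n s : nice s -> measurable_fun [set: X] (step_term (chain_sum n) s m).
Proof.
move=> ns.
have H := measurable_step_term (Y := Y) y0 g_measurable mD mh h_ge0 n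
  (nice_measurable_state unit ns).
exact: (measurableT_comp H (measurable_pair1 (tt, m))).
Qed.

Let st0 n s p : 0 <= step_term (chain_sum n) s m p.
Proof. by apply: step_term_ge0 => // *; exact: chain_sum_ge0. Qed.

Lemma final_term_neq0 s : final_term s m != 0 -> m (below s) = 0.
Proof.
rewrite /final_term indicE.
have [/set_mem //|_] := boolP (m (below s) \in _).
by rewrite mule0 eqxx.
Qed.

Lemma admits_neq0 s p : admits g s m p != 0 ->
  reachable s p /\ m (@strip d R S p.2) = 1%:E.
Proof.
rewrite /admits; case: ifP => [sp|_]; last by rewrite eqxx.
rewrite indicE; have [/set_mem //|_] := boolP (m (strip p.2) \in _).
by rewrite eqxx.
Qed.

(** An integral of a nonnegative function against the configuration vanishes
    unless the function is nonzero at some atom. *)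
Lemma chain_sum_neq0 n s : nice s -> chain_sum n s m != 0 -> valid n s.
Proof.
elim: n s => [|n ih] s ns /=; first exact: final_term_neq0.
move=> /(integral_neq0_atom (mst n ns) (st0 n s))[p Pp].
rewrite /step_term mule_eq0 negb_or => /andP[/admits_neq0[sp m1] Kp].
have [nsp _] := nice_next g_measurable g_ge0 g_density ns sp.
exists p => //; move: Kp; case: ifP => _; first exact: final_term_neq0.
exact: ih.
Qed.

Lemma final_termE s : m (below s) = 0 -> final_term s m = (h (slt_G s y0))%:E.
Proof. by move=> m0; rewrite /final_term m0 indicE mem_set// mule1. Qed.

(** All points that contribute to the outer integral give the step of the
    construction by [slt_stepE], so by injectivity of the state update there is
    only one, of mass 1. *)
Lemma chain_sumE n s : nice s -> consistent s -> valid n s ->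
  chain_sum n s m = (h (slt_G (stopped n s) y0))%:E.
Proof.
elim: n s => [|n ih] s ns cs; first exact: final_termE.
move=> [p sp vp]; have [Pp rp m1] := sp.
have [nsp _] := nice_next g_measurable g_ge0 g_density ns rp.
have below0 q : nice (slt_next s q) ->
    (if q.1 \in D then m (below (slt_next s q)) = 0 else valid n (slt_next s q)) ->
    m (below (slt_next s q)) = 0.
  by move=> nq; case: ifP => _ //; exact: valid_below.
have stepE := slt_stepE ns cs sp (below0 _ nsp vp).
have mp1 : m [set p] = 1%:E.
  apply/eqP; rewrite eq_le atom_ge1// andbT -m1.
  apply: le_measure; rewrite ?inE//; first exact: measurable_strip.
  by move=> _ ->; rewrite /strip /=.
have stopE : stopped n.+1 s =
    if p.1 \in D then slt_next s p else stopped n (slt_next s p).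
  rewrite -[LHS]/(if slt_z (slt_step g P s) \in D then slt_step g P s
                  else stopped n (slt_step g P s)).
  by rewrite stepE.
rewrite stopE -[chain_sum n.+1 s m]/(\int[m]_q step_term (chain_sum n) s m q).
rewrite (integral_single_atom (p := p) (mst n ns) (st0 n s))//.
  rewrite /step_term /admits rp m1 indicE mem_set// mul1e.
  case: (p.1 \in D) vp => vp; first exact: final_termE.
  by apply: ih => //; exact: consistent_next.
move=> q Pq qp; apply/eqP/negPn/negP.
rewrite /step_term mule_eq0 negb_or => /andP[/admits_neq0[rq mq1] Kq].
have [nsq _] := nice_next g_measurable g_ge0 g_density ns rq.
apply: qp; apply: (slt_next_inj rq); rewrite -stepE.
apply/esym/slt_stepE => //; apply: below0 => //.
move: Kq; case: ifP => _; first exact: final_term_neq0.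
exact: chain_sum_neq0.
Qed.

End functional_value.
End pathwise.

(** * Compact exhaustions and atoms of point measures *)

Section sigma_compact.
Context (d : measure_display) (R : realType) (S : measurableCompleteMetricType d R).
Hypothesis S_borel : borel_sigma_algebra S.
Hypothesis S_separable : separable S.
Hypothesis S_locally_compact : locally_compact [set: S].

Lemma measurable_open (U : set S) : open U -> measurable U.
Proof. by move=> oU; rewrite S_borel; exact: sub_sigma_algebra. Qed.

Lemma measurable_closed (U : set S) : closed U -> measurable U.
Proof.
move=> cU; rewrite -(setCK U); apply: measurableC; apply: measurable_open.
exact: closed_openC.
Qed.

Lemma measurable_singleton (y : S) : measurable [set y].
Proof.
apply: measurable_closed; apply: accessible_closed_set1; apply: hausdorff_accessible.
exact: metric_hausdorff.
Qed.

Lemma compact_neighborhood (x : S) :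
  exists2 U, nbhs x U & compact U /\ closed U.
Proof.
have [U + cU] := S_locally_compact (I : [set: S] x).
move=> xU; exists U => //.
by apply: (@filterS _ (nbhs x) _ [set y | [set: S] y -> U y]) xU => y; exact.
Qed.

Lemma countable_dense_seq : exists q : nat -> S, dense (range q).
Proof.
have [Q cQ dQ] := S_separable.
have [Q0|[f]] := pfcard_geP cQ.
  exfalso; have [|y []] := dQ setT _ openT; first by exists point.
  by rewrite Q0.
by exists f; rewrite (_ : range f = Q)//; exact: image_eq.
Qed.

(** The closed balls around a dense sequence with radius 1/(k+1) are countably
    many; those that are compact cover the space, because small enough balls are
    contained in compact neighbourhoods. *)
Lemma compact_exhaustion : exists K : nat -> set S,
  [/\ forall j, compact (K j), forall j, measurable (K j), nondecreasing_seq K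
    & \bigcup_j K j = setT].
Proof.
have [q dq] := countable_dense_seq.
pose B (i k : nat) := closure (ball (q i) (k.+1%:R^-1 : R)).
pose C (n : nat) : set S := if unpickle n is Some (i, k) then
  (if `[< compact (B i k) >] then B i k else set0) else set0.
have cC n : compact (C n).
  rewrite /C; case: unpickle => [[i k]|]; last exact: compact0.
  by case: asboolP => // _; exact: compact0.
have clC n : closed (C n).
  rewrite /C; case: unpickle => [[i k]|]; last exact: closed0.
  by case: asboolP => // _; [exact: closed_closure|exact: closed0].
exists (fun j => \big[setU/set0]_(n < j) C n); split.
- by move=> j; elim/big_ind: _ => [||n _]; [exact: compact0|exact: compactU|exact: cC].
- by move=> j; apply: bigsetU_measurable => n _; exact: measurable_closed.
- move=> i j ij; apply/subsetPset; exact: subset_bigsetU.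
- rewrite -subTset => x _.
  have [U + [cU clU]] := compact_neighborhood x.
  move=> /nbhs_ballP[e /= e0 xeU].
  have [k ke] : exists k : nat, (k.+1%:R^-1 : R) < e / 2.
    have e2 : 0 < e / 2 by rewrite divr_gt0.
    have [k] := ltr_add_invr e2; rewrite add0r => ke.
    by exists k.
  have k0 : 0 < (k.+1%:R^-1 : R) by rewrite invr_gt0.
  have [|y [/interior_subset + [i _ qy]]] :=
    dq ((ball x (k.+1%:R^-1 : R))°) _ (@open_interior _ _) => //.
  + exists x; rewrite /interior; exact: nbhsx_ballx.
  rewrite -qy => xqi.
  have sub : B i k `<=` U.
    rewrite [X in _ `<=` X](closure_id U).1//; apply: closure_subset => y' qy'.
    apply: xeU; rewrite [e]splitr; apply: (ball_triangle (y := q i)).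
      exact: le_ball (ltW ke) _ xqi.
    exact: le_ball (ltW ke) _ qy'.
  have cB : compact (B i k) by exact: subclosed_compact (@closed_closure _ _) cU sub.
  exists (pickle (i, k)).+1 => //.
  rewrite -bigcup_mkord; exists (pickle (i, k)) => /=; first exact: ltnSn.
  rewrite /C pickleK; case: asboolP => // _.
  by apply: subset_closure; exact: ball_sym.
Qed.

End sigma_compact.

Section product_exhaustion.
Context (d : measure_display) (R : realType) (S : measurableCompleteMetricType d R).
Local Notation X := (S * measurableTypeR R)%type.
Variable K : nat -> set S.
Hypotheses (mK : forall j, measurable (K j)) (ndK : nondecreasing_seq K)
  (covK : \bigcup_j K j = setT).

(** Boxes are compact, hence have finitely many points of the process. *)
Definition box (j : nat) : set X := K j `*` `[- j%:R, j%:R]%classic.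

Lemma measurable_box j : measurable (box j).
Proof. by apply: measurableX => //; exact: measurable_itv. Qed.

Lemma nondecreasing_box : nondecreasing_seq box.
Proof.
move=> i j ij; apply/subsetPset => -[y v] [/= Ky].
rewrite !in_itv/= => /andP[iv vi]; split => /=.
  by have /subsetPset := ndK ij; exact.
have ijR : (i%:R : R) <= j%:R by rewrite ler_nat.
by rewrite in_itv/= (le_trans _ iv) ?lerN2// (le_trans vi).
Qed.

Lemma cover_box : \bigcup_j box j = setT.
Proof.
rewrite -subTset => -[y v] _.
have [i _ Ky] : (\bigcup_j K j) y by rewrite covK.
pose n := (Num.truncn `|v|).+1.
exists (maxn i n) => //; split => /=.
  by have /subsetPset := ndK (leq_maxl i n); exact.
rewrite in_itv/= -ler_norml; apply: (le_trans (ltW (truncnS_gt _))).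
by rewrite ler_nat leq_maxr.
Qed.

Definition box_exhaustion : exhaustion X :=
  Exhaustion measurable_box nondecreasing_box cover_box.

End product_exhaustion.

Section point_measures.
Local Open Scope ereal_scope.
Context (d : measure_display) (R : realType) (S : measurableCompleteMetricType d R).
Local Notation X := (S * measurableTypeR R)%type.
Variables (m : {measure set X -> \bar R}) (L : set nat) (p : nat -> X).
Hypothesis mE : forall A, measurable A -> m A = \esum_(i in L) \d_(p i) A.

Let sum_one (s : seq nat) : \sum_(i <- s) (1%:E : \bar R) = (size s)%:R%:E.
Proof.
elim: s => [|i s ih]; first by rewrite big_nil.
by rewrite big_cons ih /= -EFinD -natr1 addrC.
Qed.

Lemma point_measureE A : measurable A ->
  m A = \esum_(i in L `&` (p @^-1` A)) (1%:E : \bar R).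
Proof.
move=> mA; rewrite mE// esum_mkcondr; apply: eq_esum => i _.
rewrite diracE; have [/set_mem pA|/negP pA] := boolP (p i \in A).
  by rewrite mem_set.
by rewrite memNset// => pA'; apply: pA; exact/mem_set.
Qed.

(** A sum of Dirac masses counts the indices whose point lies in A; an infinite
    set of indices has infinite mass. *)
Lemma point_measure_nat A : measurable A -> m A < +oo ->
  exists k : nat, m A = k%:R%:E.
Proof.
move=> mA; rewrite point_measureE//; set J := L `&` _ => Joo.
have [fJ|iJ] := pselect (finite_set J).
  rewrite esum_fset// fsbig_finite// sum_one.
  by eexists.
exfalso; move: Joo; rewrite ltNge => /negP; apply.
rewrite leye_eq; apply/eqP/eq_infty => t; apply: esum_ge.
have [B BJ nB] := infinite_set_fset (Num.truncn t).+1 iJ.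
eexists; first by split; [exact: (finite_fset B)|exact: BJ].
rewrite fsbig_finite ?finite_fset// set_fsetK sum_one lee_fin.
by rewrite (le_trans (ltW (truncnS_gt _)))// ler_nat.
Qed.

Lemma point_measure_atomic A : (forall q : X, measurable [set q]) ->
  measurable A -> m A != 0 -> exists2 q, atoms m q & A q.
Proof.
move=> m1 mA; apply: contra_neqP => nA.
rewrite point_measureE// esum1// => i [Li /= pA]; exfalso; apply: nA.
exists (p i) => //; rewrite /atoms /= point_measureE//.
apply: (@lt_le_trans _ _ 1%:E) => //; apply: esum_ge; exists [set i].
  by split; [exact: finite_set1|move=> _ ->].
by rewrite fsbig_set1.
Qed.

End point_measures.

(** * The point process as a random configuration *)

Section point_process_configuration.
Local Open Scope ereal_scope.
Context (d : measure_display) (R : realType) (S : measurableCompleteMetricType d R).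
Local Notation X := (S * measurableTypeR R)%type.

Lemma measurable_singleton_pair : borel_sigma_algebra S ->
  forall p : X, measurable [set p].
Proof.
move=> S_borel p; rewrite (_ : [set p] = [set p.1] `*` [set p.2]).
  by apply: measurableX; [exact: measurable_singleton|exact: measurable_set1].
by case: p => y v; apply/seteqP; split => [_ ->//|[y' v'] /= [-> ->]].
Qed.

(** Restricting the set to nonnegative heights or restricting the Lebesgue
    measure gives the same sections. *)
Lemma intensity_ground (mu : {sigma_finite_measure set S -> \bar R}) A :
  intensity mu A = ground_measure mu A.
Proof.
rewrite /intensity /ground_measure /product_measure1 /=.
apply: eq_integral => y _ /=; rewrite /halfline_measure /mrestr.
congr (lebesgue_measure _); apply/seteqP; split => v.
  by move=> /xsectionP[Ayv /= v0]; split; [exact/xsectionP|rewrite /= in_itv/= v0].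
by move=> [/xsectionP Ayv]; rewrite /= in_itv/= andbT => v0; apply/xsectionP.
Qed.

Lemma radon_sigma_finite (mu : {measure set S -> \bar R}) (K : nat -> set S) :
  radon mu -> (forall j, compact (K j)) -> (forall j, measurable (K j)) ->
  \bigcup_j K j = setT ->
  exists mu' : {sigma_finite_measure set S -> \bar R},
    mu' = mu :> {measure set S -> \bar R}.
Proof.
move=> [mu_compact _] cK mK covK.
have sf : sigma_finite setT mu.
  by exists K => // j; split => //; exact: mu_compact.
(* The packed measure has the same underlying function as mu. *)
pose H2 := isSFinite.Build _ _ _ mu (sfinite_measure_sigma_finite sf).
pose H3 := isSigmaFinite.Build _ _ _ mu sf.
pose mu' := HB.pack_for (SigmaFiniteMeasure.type S R) (Measure.sort mu) H2 H3.
by exists mu'; exact: eq_measure.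
Qed.

Section law.
Variable mu : {sigma_finite_measure set S -> \bar R}.
Variable K : nat -> set S.
Hypotheses (cK : forall j, compact (K j)) (mK : forall j, measurable (K j))
  (ndK : nondecreasing_seq K) (covK : \bigcup_j K j = setT)
  (muK : forall j, mu (K j) < +oo).
Context (dO : measure_display) (Omega : measurableType dO) (Q : probability Omega R).
Variable eta : Omega -> {measure set X -> \bar R}.
Hypothesis eta_ppp : poisson_point_process mu Q eta.

Let Y := box_exhaustion mK ndK covK.

Lemma bounded_count_nat w A : measurable A -> bounded_in Y A ->
  exists k : nat, eta w A = k%:R%:E.
Proof.
move=> mA [j Aj]; have [eta_pm _ _ _ _] := eta_ppp.
have [[L [p [_ eE]]] fin] := eta_pm w.
apply: (point_measure_nat eE) => //.
apply: le_lt_trans (fin (box K j) _).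
  by apply: le_measure; rewrite ?inE//; exact: (measurable_box mK).
by apply: compact_setX => //; exact: segment_compact.
Qed.

Definition configuration_of (w : Omega) : config R Y := Config (bounded_count_nat w).

(** The joint law of the counts comes from their independence and their Poisson
    marginals; an arbitrary finite index type is enumerated to match
    independence along 0, ..., n-1. *)
Lemma poisson_configuration : poisson_law Q (ground_measure mu) configuration_of.
Proof.
have [eta_pm eta_mes law_fin _ indep] := eta_ppp.
have nu_fin A : measurable A -> bounded_in Y A -> ground_measure mu A < +oo.
  move=> mA [j Aj]; apply: (@le_lt_trans _ _ (ground_measure mu (box K j))).
    by apply: le_measure; rewrite ?inE//; exact: (measurable_box mK).
  rewrite /ground_measure /box product_measure1E//.
  apply: lte_mul_pinfty; first exact: measure_ge0.
    by rewrite ge0_fin_numE; [exact: muK|exact: measure_ge0].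
  have mI : measurable (`[(- j%:R)%R : R, j%:R%R]%classic : set (measurableTypeR R)).
    exact: measurable_itv.
  have I1 : @halfline_measure R `[(- j%:R)%R, j%:R%R]%classic <=
      @lebesgue_measure R `[(- j%:R)%R, j%:R%R]%classic.
    rewrite /halfline_measure /mrestr; apply: le_measure; rewrite ?inE//.
    by apply: measurableI => //; exact: measurable_itv.
  apply: (le_lt_trans I1).
  by rewrite lebesgue_measure_itv/=; case: ifP => _; rewrite ?ltry// -EFinB ltry.
have count A k : measurable A -> ground_measure mu A < +oo ->
    Q [set w | eta w A = k%:R%:E] =
    (poisson_weight (fine (ground_measure mu A)) k)%:E.
  by move=> mA Aoo; rewrite law_fin// intensity_ground.
split => //.
- by apply: measurable_to_config => A mA _; exact: eta_mes.
- move=> J D k [mD bD tD].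
  pose D' (i : 'I_#|J|) := D (enum_val i).
  pose B (i : 'I_#|J|) : set (\bar R) := [set (k (enum_val i))%:R%:E].
  have tD' : trivIset setT D'.
    move=> i i' _ _ /tD ii'; apply: enum_val_inj; exact: ii'.
  have := indep #|J| D' B (fun i => mD _) tD' (fun i => emeasurable_set1 _).
  rewrite (_ : \bigcap_(i in _) _ =
      [set w | forall i, configuration_of w (D i) = (k i)%:R%:E]); last first.
    apply/seteqP; split => w /= H i; last by move=> _; exact: H.
    by have := H (enum_rank i) I; rewrite /D' /B /= enum_rankK.
  move=> ->; rewrite -prodEFin.
  rewrite [RHS](reindex_onto (enum_val : 'I_#|J| -> J) enum_rank)/=; last first.
    by move=> i _; rewrite enum_rankK.
  apply: eq_big => [i|i _]; first by rewrite enum_valK eqxx.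
  by rewrite count //; [exact: mD|apply: nu_fin; [exact: mD|exact: bD]].
- move=> A mA Aoo; have := count A 0%N mA Aoo.
  by rewrite /poisson_weight expr0 fact0 divr1 mul1r => <-.
Qed.

End law.
End point_process_configuration.

(** * Integrals modulo null sets, moment bounds and stopped iterates *)

Section null_sets.
Import HBNNSimple.
Local Open Scope ereal_scope.
Context (dT : measure_display) (T : measurableType dT) (R : realType).
Variable mu : {measure set T -> \bar R}.
Implicit Types f k : T -> \bar R.

Lemma ge0_integral_le f k : (forall x, 0 <= f x) -> (forall x, f x <= k x) ->
  \int[mu]_x f x <= \int[mu]_x k x.
Proof.
move=> f0 fk; have k0 x : 0 <= k x by exact: le_trans (fk x).
rewrite !ge0_integralTE//; apply: ereal_sup_le => _ [h hf <-].
by exists h => // x; exact: le_trans (fk x).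
Qed.

Lemma patch_ge0 f A : (forall x, 0 <= f x) -> forall x, 0 <= (f \_ A) x.
Proof. by move=> f0 x; rewrite patchE; case: ifP. Qed.

(** The integral is a supremum over simple functions below the integrand, and
    each simple function may be set to 0 on the null set without changing its
    integral. *)
Lemma integral_off_null_set f A : measurable A -> mu A = 0 ->
  (forall x, 0 <= f x) -> \int[mu]_x f x = \int[mu]_x (f \_ (~` A)) x.
Proof.
move=> mA A0 f0; apply/eqP; rewrite eq_le; apply/andP; split; last first.
  apply: ge0_integral_le; first exact: patch_ge0.
  by move=> x; rewrite patchE; case: ifP.
rewrite [leLHS]ge0_integralTE//; apply: ge_ereal_sup => _ [h hf <-].
have mh : measurable_fun [set: T] (fun x => (h x)%:E) by exact/measurable_EFinP.
have h0 x : 0 <= (h x)%:E by rewrite lee_fin.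
have -> : sintegral mu h = \int[mu]_x (h x)%:E.
  by rewrite integral_nnsfun// patch_setT.
rewrite (ge0_negligible_integral mA measurableT mh)// setTD integral_mkcond.
apply: ge0_integral_le; first exact: patch_ge0.
by move=> x; rewrite !patchE; case: ifP.
Qed.

Lemma ge0_integral_eq_ae f k : (forall x, 0 <= f x) -> (forall x, 0 <= k x) ->
  {ae mu, forall x, f x = k x} -> \int[mu]_x f x = \int[mu]_x k x.
Proof.
move=> f0 k0 [A [mA A0 sub]].
rewrite (integral_off_null_set mA A0 f0) (integral_off_null_set mA A0 k0).
apply: eq_integral => x _; rewrite !patchE; case: ifPn => // /set_mem nA.
by apply: contrapT => fk; apply: nA; exact: sub.
Qed.

(** Outside one common null set the f_n are measurable, and the classical
    theorem applies to their restrictions. *)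
Lemma monotone_convergence_ae (f k : nat -> T -> \bar R) :
  (forall n x, 0 <= f n x) -> (forall x, nondecreasing_seq (f ^~ x)) ->
  (forall n, measurable_fun [set: T] (k n)) ->
  {ae mu, forall x, forall n, f n x = k n x} ->
  \int[mu]_x limn (f ^~ x) = limn (fun n => \int[mu]_x f n x).
Proof.
move=> f0 ndf mk [A [mA A0 sub]].
have off n x : ~ A x -> f n x = k n x.
  by move=> nA; apply: contrapT => fk; apply: nA; apply: sub => /= H; exact: fk.
have mf n : measurable_fun [set: T] (f n \_ (~` A)).
  rewrite (_ : _ \_ _ = k n \_ (~` A)); last first.
    by apply/funext => x; rewrite !patchE; case: ifPn => // /set_mem /off.
  apply/(measurable_restrict _ (measurableC mA) measurableT).
  by rewrite setTI; exact: measurable_funTS.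
have lim0 x : 0 <= limn (f ^~ x).
  apply: lime_ge; first exact: ereal_nondecreasing_is_cvgn.
  by near=> n; exact: f0.
rewrite (integral_off_null_set mA A0 lim0).
under [in RHS]eq_fun do rewrite (integral_off_null_set mA A0 (f0 _)).
rewrite -monotone_convergence//.
- apply: eq_integral => x _; rewrite patchE; case: ifPn => Ax.
    by congr (limn _); apply/funext => n; rewrite patchE Ax.
  apply/esym; rewrite -[RHS](@lim_cst _ (@ereal_hausdorff R) _ \oo).
  by congr (limn _); apply/funext => n; rewrite patchE (negbTE Ax).
- by move=> n x _; exact: patch_ge0.
- move=> x _ i j ij; rewrite !patchE; case: ifP => // _; exact: ndf.
Unshelve. all: by end_near. Qed.

End null_sets.

Section moment_bounds.
Local Open Scope ereal_scope.
Context (d : measure_display) (R : realType) (S : measurableCompleteMetricType d R).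
Variables (g : S -> S -> R) (z : S) (D : set S).
Hypothesis g_measurable : measurable_fun [set: S * S] (fun p : S * S => g p.1 p.2).
Hypothesis g_ge0 : forall y y', (0 <= g y y')%R.
Hypothesis mD : measurable D.
Variable mu : {sigma_finite_measure set S -> \bar R}.

Local Notation transfer := (transfer g D mu).
Local Notation survive := (survive D).
Local Notation mean := (mean g z D mu).
Local Notation second := (second g z D mu).

Let mterm x (f : S -> \bar R) : measurable_fun [set: S] f ->
  measurable_fun [set: S] (fun y => (g x y)%:E * survive f y).
Proof.
move=> mf; apply: emeasurable_funM.
  by apply/measurable_EFinP; exact: measurable_density.
exact: measurable_survive.
Qed.

Let term0 x (f : S -> \bar R) : (forall y, 0 <= f y) ->
  forall y, 0 <= (g x y)%:E * survive f y.
Proof. by move=> f0 y; rewrite mule_ge0 ?lee_fin// survive_ge0. Qed.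

Lemma transfer_le f k x : (forall y, 0 <= f y) -> (forall y, f y <= k y) ->
  transfer f x <= transfer k x.
Proof.
move=> f0 fk; apply: ge0_integral_le => y; first exact: term0.
by apply: lee_wpmul2l; rewrite ?lee_fin// /survive; case: ifP.
Qed.

Lemma transferZ (c : \bar R) f x : 0 <= c -> (forall y, 0 <= f y) ->
  measurable_fun [set: S] f -> transfer (fun y => c * f y) x = c * transfer f x.
Proof.
move=> c0 f0 mf; rewrite /transfer -ge0_integralZl//; last first.
- by move=> y _; exact: term0.
- exact: mterm.
apply: eq_integral => y _; rewrite /survive; case: ifP => _.
  by rewrite !mule0.
by rewrite muleCA.
Qed.

Lemma mean_nondecreasing x : nondecreasing_seq (mean ^~ x).
Proof.
apply/nondecreasing_seqP => n; elim: n x => [|n ih] x.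
  exact: mean_ge0.
by apply: leeD => //; apply: transfer_le => // y; exact: mean_ge0.
Qed.

Lemma second_nondecreasing x : nondecreasing_seq (second ^~ x).
Proof.
apply/nondecreasing_seqP => n; elim: n x => [|n ih] x.
  exact: second_ge0.
apply: leeD; last by apply: transfer_le => // y; exact: second_ge0.
apply: leeD => //; apply: lee_wpmul2l; first by rewrite lee_fin mulr_ge0.
apply: transfer_le => y; first exact: mean_ge0.
by apply: (mean_nondecreasing y); exact: leqnSn.
Qed.

(** The first two terms of the recursion add up to 2 g(x, z) m_(n+1)(x), and the
    first factor m_(n+1)(x) is bounded by M.  Since the m_n increase with n, a
    bound on the last one is enough. *)
Lemma second_le n (M : \bar R) : (forall x, mean n x <= M) ->
  forall x, second n x <= 2%:E * M * mean n x.
Proof.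
elim: n => [|n ih] MM x; first by rewrite mule0.
have M0 : 0 <= M by exact: le_trans (mean_ge0 z D g_ge0 mu n.+1 x) (MM x).
have ihM y : second n y <= 2%:E * M * mean n y.
  apply: ih => y'; apply: le_trans (MM y').
  by apply: (mean_nondecreasing y'); exact: leqnSn.
have M20 : 0 <= 2%:E * M by rewrite mule_ge0.
have TS : transfer (second n) x <= 2%:E * M * transfer (mean n) x.
  rewrite -transferZ//; [|exact: mean_ge0|exact: measurable_mean].
  by apply: transfer_le => // y; exact: second_ge0.
have := MM x; rewrite -[mean n.+1 x]/((g x z)%:E + transfer (mean n) x).
rewrite -[second n.+1 x]/((2 * g x z ^+ 2)%:E + (2 * g x z)%:E * transfer (mean n) x
                          + transfer (second n) x).
have : 0 <= transfer (mean n) x by apply: transfer_ge0 => // y; exact: mean_ge0.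
move: (transfer (mean n) x) (transfer (second n) x) TS => T1 T2 TS T10 TM.
rewrite [leRHS]ge0_muleDr ?lee_fin//; apply: leeD => //.
have -> : (2 * g x z ^+ 2)%:E + (2 * g x z)%:E * T1 =
    2%:E * (g x z)%:E * ((g x z)%:E + T1).
  by rewrite ge0_muleDr ?lee_fin// -!EFinM expr2 mulrA.
rewrite -!muleA; apply: lee_wpmul2l => //.
by rewrite muleC; apply: lee_wpmul2r => //; rewrite lee_fin.
Qed.

End moment_bounds.

Section iterates.
Context (d : measure_display) (R : realType) (S : measurableCompleteMetricType d R).
Variable Y : exhaustion (S * measurableTypeR R)%type.
Variables (g : S -> S -> R) (D : set S) (m : config R Y).
Hypothesis g_ge0 : forall y y', 0 <= g y y'.

Local Notation step := (slt_step g (atoms m)).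
Local Notation stopped := (stopped g D m).

Lemma slt_step_ge (s : slt_state S) y : slt_G s y <= slt_G (step s) y.
Proof.
rewrite /= lerDl mulr_ge0//; set A := [set t | _].
have [->|/set0P[t At]] := eqVneq A set0; first by rewrite inf0.
by apply: lb_le_inf; [exists t|move=> t' []].
Qed.

Lemma stopped_nondecreasing s y : nondecreasing_seq (fun n => slt_G (stopped n s) y).
Proof.
apply/nondecreasing_seqP => n; elim: n s => [|n ih] s.
  rewrite -[stopped 1 s]/(if slt_z (step s) \in D then step s else step s).
  by rewrite if_same; exact: slt_step_ge.
rewrite -[stopped n.+2 s]/(if slt_z (step s) \in D then step s else stopped n.+1 (step s)).
rewrite -[stopped n.+1 s]/(if slt_z (step s) \in D then step s else stopped n (step s)).
by case: ifP.
Qed.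

Lemma stopped_before n s :
  (forall k, (0 < k <= n)%N -> slt_z (iter k step s) \notin D) ->
  stopped n s = iter n step s.
Proof.
elim: n s => [//|n ih] s out.
rewrite -[stopped n.+1 s]/(if slt_z (step s) \in D then step s else stopped n (step s)).
rewrite (negbTE (out 1%N _))// iterSr; apply: ih => k /andP[k0 kn].
by rewrite -iterSr; exact: out.
Qed.

Lemma stopped_after n s j : (0 < n <= j)%N ->
  (forall k, (0 < k < n)%N -> slt_z (iter k step s) \notin D) ->
  slt_z (iter n step s) \in D -> stopped j s = iter n step s.
Proof.
elim: n s j => [//|n ih] s [//|j] nj out.
rewrite -[stopped j.+1 s]/(if slt_z (step s) \in D then step s else stopped j (step s)).
case: n => [|n] in ih nj out *; first by move=> /= ->.
rewrite (negbTE (out 1%N _))// => hit; rewrite iterSr; apply: ih => //; last first.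
  by rewrite -iterSr.
move=> k /andP[k0 kn].
by rewrite -iterSr; exact: out.
Qed.

End iterates.

(** If the chain hits Delta at time n, the stopped local time is eventually
    constant equal to G_n; otherwise stopping has no effect and both sides are
    the same limit. *)
Lemma slt_at_hittingE (d : measure_display) (R : realType)
    (S : measurableCompleteMetricType d R) (Y : exhaustion (S * measurableTypeR R)%type)
    (g : S -> S -> R) (Delta : S) (m : config R Y) (x z : S) :
  slt_at_hitting g Delta (atoms m) x z =
  limn (fun n => (slt_G (stopped g [set Delta] m n (SltState (fun=> 0) set0 x)) z)%:E).
Proof.
rewrite /slt_at_hitting /hitting_time; case: pselect => [hit|nohit] /=; last first.
  congr (limn _); apply/funext => n; rewrite stopped_before// => k /andP[k0 _].
  rewrite notin_setE => xk; apply: nohit; exists k; apply/asboolP; split => //.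
case: ex_minnP => n /asboolP[n0 xn] nmin.
apply/esym/lim_near_cst => //; exists n => // j /= nj.
rewrite (stopped_after (n := n))//; first by rewrite n0.
- move=> k /andP[k0 kn]; rewrite notin_setE => xk.
  by have := nmin k (asboolT (conj k0 xk)); rewrite leqNgt kn.
- exact/mem_set.
Qed.

(** * Moments of the stopped local time *)

Section almost_sure.
Local Open Scope ereal_scope.
Context (d : measure_display) (R : realType) (S : measurableCompleteMetricType d R).
Local Notation X := (S * measurableTypeR R)%type.
Variable Y : exhaustion X.
Variables (g : S -> S -> R) (D : set S).
Hypothesis g_measurable : measurable_fun [set: S * S] (fun p : S * S => g p.1 p.2).
Hypothesis g_ge0 : forall y y', (0 <= g y y')%R.
Hypothesis mD : measurable D.
Variable mu : {sigma_finite_measure set S -> \bar R}.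
Hypothesis g_density : forall y, \int[mu]_y' (g y y')%:E = 1.
Context (dO : measure_display) (Omega : measurableType dO) (Q : probability Omega R).
Variable N : Omega -> config R Y.
Hypothesis pN : poisson_law Q (ground_measure mu) N.
Hypothesis measurable_point : forall p : X, measurable [set p].
Hypothesis N_atomic : forall w (A : set X), measurable A -> N w A != 0 ->
  exists2 p, atoms (N w) p & A p.

Let mN := poisson_law_measurable pN.

Definition slt_start (x : S) : slt_state S := SltState (fun=> 0%R) set0 x.

Lemma nice_start x : nice mu (slt_start x).
Proof.
by split => //=; rewrite integral0.
Qed.

Lemma area_start x : area mu (slt_start x) = 0%R.
Proof. by rewrite /area /= integral0. Qed.

Lemma consistent_start w x : consistent (N w) (slt_start x).
Proof. by move=> q _ /asboolP[]. Qed.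

Lemma measurable_chain_sum_start z (h : R -> R) n x : measurable_fun [set: R] h ->
  (forall a, (0 <= h a)%R) ->
  measurable_fun [set: Omega] (fun w => chain_sum g z D h n (slt_start x) (N w)).
Proof.
move=> mh h0.
have H := measurable_chain_sum (Y := Y) z g_measurable mD mh h0 n
  (nice_measurable_state unit (nice_start x)).
have mtN : measurable_fun [set: Omega] (fun w => (tt, N w)).
  exact: measurable_fun_pair.
exact: (measurableT_comp H mtN).
Qed.

(** Apply the two evaluations of the chain sum to h = 1: pathwise it is 0 or 1,
    and its mean is 1. *)
Lemma almost_surely_valid n x :
  {ae Q, forall w, valid g D (N w) n (slt_start x)}.
Proof.
pose h := fun _ : R => 1%R : R.
have mh : measurable_fun [set: R] h by exact: measurable_cst.
have h0 a : (0 <= h a)%R by exact: ler01.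
pose f w := chain_sum g x D h n (slt_start x) (N w).
have mf : measurable_fun [set: Omega] f by exact: measurable_chain_sum_start.
have fv w : f w != 0 -> valid g D (N w) n (slt_start x).
  exact: (chain_sum_neq0 g_measurable g_ge0 mD g_density (@N_atomic w) mh h0 (nice_start x)).
have f1 w : f w != 0 -> f w = 1.
  move=> /fv v; rewrite /f.
  by rewrite (chain_sumE x g_measurable g_ge0 mD g_density measurable_point
    (@N_atomic w) mh h0 (nice_start x) (@consistent_start w x) v).
have mA : measurable [set w | f w != 0].
  rewrite -[X in measurable X]setTI; exact: emeasurable_neq.
(* f is the indicator of the event where it does not vanish. *)
have QA : Q [set w | f w != 0] = 1.
  rewrite -[LHS]mul1e -[in LHS](setIT [set w | f w != 0]).
  rewrite -integral_indic// mul1e.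
  transitivity (\int[Q]_w f w).
    apply: eq_integral => w _; rewrite indicE.
    have [/set_mem /= /f1 -> //|] := boolP (w \in _).
    by rewrite notin_setE /= => /negP; rewrite negbK => /eqP ->.
  have hq a : (0 <= a)%R -> h a = quad 1 0 0 a by rewrite /quad !mul0r !addr0.
  rewrite /f (expectation_chain_sum (Y := Y) x g_measurable g_ge0 mD mh h0 g_density
    pN ler01 (lexx 0%R) (lexx 0%R) hq n (nice_start x)).
  by rewrite area_start oppr0 expR0 mul1e /moment /quad !(mulr0, mul0r, addr0, mul0e, adde0).
exists (~` [set w | f w != 0]); split.
- exact: measurableC.
- by rewrite probability_setC// QA subee.
- by move=> w /= nv fw; apply: nv; exact: fv.
Qed.

Local Notation G n x z w := (slt_G (stopped g D (N w) n (slt_start x)) z).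

Lemma stopped_ge0 n x z w : (0 <= G n x z w)%R.
Proof. exact: (stopped_nondecreasing D (N w) g_ge0 (slt_start x) z (leq0n n)). Qed.

Section quadratic.
Variables (h : R -> R) (c0 c1 c2 : R).
Hypotheses (mh : measurable_fun [set: R] h) (h_ge0 : forall a, (0 <= h a)%R).
Hypotheses (c0_ge0 : (0 <= c0)%R) (c1_ge0 : (0 <= c1)%R) (c2_ge0 : (0 <= c2)%R).
Hypothesis h_quad : forall a, (0 <= a)%R -> h a = quad c0 c1 c2 a.

Lemma stopped_chain_sum z x :
  {ae Q, forall w, forall n, (h (G n x z w))%:E = chain_sum g z D h n (slt_start x) (N w)}.
Proof.
apply: ae_foralln => n; apply: filterS (almost_surely_valid n x) => w v.
by rewrite (chain_sumE z g_measurable g_ge0 mD g_density measurable_point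
    (@N_atomic w) mh h_ge0 (nice_start x) (@consistent_start w x) v).
Qed.

Lemma expectation_stopped n z x : \int[Q]_w (h (G n x z w))%:E =
  moment c0 c1 c2 (mean g z D mu n) (second g z D mu n) x 0.
Proof.
have E := expectation_chain_sum (Y := Y) z g_measurable g_ge0 mD mh h_ge0 g_density
    pN c0_ge0 c1_ge0 c2_ge0 h_quad n (nice_start x).
rewrite area_start oppr0 expR0 mul1e in E; apply: etrans E.
apply: ge0_integral_eq_ae.
- by move=> w; rewrite lee_fin.
- by move=> w; exact: chain_sum_ge0.
- by apply: filterS (stopped_chain_sum z x) => w; exact.
Qed.

End quadratic.

Let mnorm : measurable_fun [set: R] (@Num.norm R R) := @normr_measurable R setT.

Let msquare : measurable_fun [set: R] (fun a : R => (a ^+ 2)%R).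
Proof. by apply: measurable_funX; exact: measurable_id. Qed.

Let norm_quad (a : R) : (0 <= a)%R -> `|a|%R = quad 0 1 0 a.
Proof. by move=> a0; rewrite ger0_norm// /quad mul1r mul0r add0r addr0. Qed.

Let square_quad (a : R) : (0 <= a)%R -> (a ^+ 2)%R = quad 0 0 1 a.
Proof. by move=> a0; rewrite /quad mul1r mul0r !add0r. Qed.

Let square0 (a : R) : (0 <= a ^+ 2)%R. Proof. exact: sqr_ge0. Qed.

Lemma expectation_stopped_mean n z x :
  \int[Q]_w (G n x z w)%:E = mean g z D mu n x.
Proof.
under eq_integral do rewrite -(ger0_norm (stopped_ge0 _ _ _ _)).
rewrite (expectation_stopped mnorm (@normr_ge0 _ R) (lexx 0%R) ler01 (lexx 0%R) norm_quad).
rewrite /moment /quad expr0n/=.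
by rewrite !(mulr0, mul0r, addr0, mul0e, adde0, mul1e, add0e).
Qed.

Lemma expectation_stopped_second n z x :
  \int[Q]_w ((G n x z w)%:E ^+ 2) = second g z D mu n x.
Proof.
under eq_integral do rewrite expe2 -EFinM -expr2.
rewrite (expectation_stopped msquare square0 (lexx 0%R) (lexx 0%R) ler01 square_quad).
rewrite /moment /quad expr0n/=.
by rewrite !(mulr0, mul0r, addr0, mul0e, adde0, mul1e, add0e).
Qed.

Local Notation Glim x z w := (limn (fun n => (G n x z w)%:E)).

Let Gnd x z w : nondecreasing_seq (fun n => (G n x z w)%:E).
Proof. by move=> i j ij; rewrite lee_fin; exact: stopped_nondecreasing. Qed.

Lemma expectation_limit z x :
  \int[Q]_w Glim x z w = limn (fun n => mean g z D mu n x).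
Proof.
rewrite (monotone_convergence_ae (f := fun n w => (G n x z w)%:E)
  (k := fun n w => chain_sum g z D (@Num.norm R R) n (slt_start x) (N w))).
- by congr (limn _); apply/funext => n; exact: expectation_stopped_mean.
- by move=> n w; rewrite lee_fin; exact: stopped_ge0.
- by move=> w; exact: Gnd.
- by move=> n; exact: measurable_chain_sum_start.
- apply: filterS (stopped_chain_sum mnorm (@normr_ge0 _ R) z x) => w H n.
  by rewrite -H ger0_norm// stopped_ge0.
Qed.

(** Squares of a convergent sequence of extended reals converge to the square of
    the limit, infinite or not, so monotone convergence applies to the squares. *)
Lemma expectation_limit_square z x :
  \int[Q]_w (Glim x z w ^+ 2) = limn (fun n => second g z D mu n x).
Proof.
under eq_integral => w _.
  rewrite expe2 -(cvg_lim (@ereal_hausdorff R) (cvgeM _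
    (ereal_nondecreasing_is_cvgn (Gnd x z w)) (ereal_nondecreasing_is_cvgn (Gnd x z w)))).
  over.
  by case: (limn _).
rewrite (monotone_convergence_ae (f := fun n w => (G n x z w)%:E * (G n x z w)%:E)
  (k := fun n w => chain_sum g z D (fun a => (a ^+ 2)%R) n (slt_start x) (N w))).
- congr (limn _); apply/funext => n; rewrite -expectation_stopped_second.
  by under eq_integral do rewrite -expe2.
- by move=> n w; rewrite mule_ge0// lee_fin stopped_ge0.
- by move=> w i j ij; apply: lee_pmul; rewrite ?lee_fin ?stopped_ge0//; exact: Gnd.
- by move=> n; exact: measurable_chain_sum_start.
- apply: filterS (stopped_chain_sum msquare square0 z x) => w H n.
  by rewrite -H expr2 EFinM.
Qed.

End almost_sure.

(** * The second moment bounds *)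

Section bounds.
Local Open Scope ereal_scope.
Context (d : measure_display) (R : realType) (S : measurableCompleteMetricType d R).
Local Notation X := (S * measurableTypeR R)%type.
Variable Y : exhaustion X.
Variable g : S -> S -> R.
Hypothesis g_measurable : measurable_fun [set: S * S] (fun p : S * S => g p.1 p.2).
Hypothesis g_ge0 : forall y y', (0 <= g y y')%R.
Variable mu : {sigma_finite_measure set S -> \bar R}.
Hypothesis g_density : forall y, \int[mu]_y' (g y y')%:E = 1.
Context (dO : measure_display) (Omega : measurableType dO) (Q : probability Omega R).
Variable N : Omega -> config R Y.
Hypothesis pN : poisson_law Q (ground_measure mu) N.
Hypothesis measurable_point : forall p : X, measurable [set p].
Hypothesis N_atomic : forall w (A : set X), measurable A -> N w A != 0 ->
  exists2 p, atoms (N w) p & A p.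

(** The constant 2 of [second_le] is relaxed to 4. *)
Let double_le (m M : \bar R) : 0 <= m -> 0 <= M -> 2%:E * M * m <= 4%:E * m * M.
Proof.
move=> m0 M0; rewrite -!muleA [m * M]muleC; apply: lee_wpmul2r.
  by rewrite mule_ge0.
by rewrite lee_fin ler_nat.
Qed.

Lemma fixed_time_bound n z x :
  \int[Q]_w ((soft_local_time g (atoms (N w)) x n z)%:E ^+ 2) <=
  4%:E * (\int[Q]_w (soft_local_time g (atoms (N w)) x n z)%:E) *
  ereal_sup [set \int[Q]_w (soft_local_time g (atoms (N w)) x' n z)%:E
            | x' in [set: S]].
Proof.
have sltE w x' : soft_local_time g (atoms (N w)) x' n z =
    slt_G (stopped g set0 (N w) n (slt_start x')) z.
  by rewrite stopped_before// => k _; rewrite notin_setE.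
have m1 x' : \int[Q]_w (soft_local_time g (atoms (N w)) x' n z)%:E =
    mean g z set0 mu n x'.
  under eq_integral do rewrite sltE.
  exact: expectation_stopped_mean.
rewrite m1; under eq_integral do rewrite sltE.
rewrite (expectation_stopped_second g_measurable g_ge0 measurable0 g_density pN
  measurable_point N_atomic).
set M := ereal_sup _.
have mM x' : mean g z set0 mu n x' <= M.
  by apply: ereal_sup_ubound; exists x'.
apply: (le_trans (second_le g_measurable g_ge0 measurable0 mM x)).
apply: double_le; first exact: mean_ge0.
exact: le_trans (mean_ge0 z set0 g_ge0 mu n x) (mM x).
Qed.

Lemma hitting_time_bound (Delta : S) z x :
  \int[Q]_w (slt_at_hitting g Delta (atoms (N w)) x z ^+ 2) <=
  4%:E * (\int[Q]_w slt_at_hitting g Delta (atoms (N w)) x z) *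
  ereal_sup [set \int[Q]_w slt_at_hitting g Delta (atoms (N w)) x' z
            | x' in [set: S]].
Proof.
have mDelta : measurable [set Delta].
  rewrite (_ : [set Delta] = ysection [set (Delta, 0%R : measurableTypeR R)] 0%R).
    exact: measurable_ysection.
  by apply/seteqP; split => y; [move=> ->; apply/ysectionP|move=> /ysectionP[->]].
pose D := [set Delta].
pose m x' := limn (fun n => mean g z D mu n x').
have m1 x' : \int[Q]_w slt_at_hitting g Delta (atoms (N w)) x' z = m x'.
  under eq_integral do rewrite slt_at_hittingE.
  exact: expectation_limit.
have mean_cvg x' : cvgn (fun n => mean g z D mu n x').
  by apply: ereal_nondecreasing_is_cvgn; exact: mean_nondecreasing.
have mean_m n x' : mean g z D mu n x' <= m x'.
  apply: lime_ge (mean_cvg x') _; exists n => // j /= nj.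
  exact: (mean_nondecreasing z D g_ge0 mu x' nj).
rewrite m1; under eq_integral do rewrite slt_at_hittingE.
rewrite (expectation_limit_square g_measurable g_ge0 mDelta g_density pN
  measurable_point N_atomic).
set M := ereal_sup _.
have mM x' : m x' <= M by apply: ereal_sup_ubound; exists x'.
have m0 x' : 0 <= m x' by exact: le_trans (mean_ge0 z D g_ge0 mu 0 x') (mean_m 0%N x').
have M0 : 0 <= M by exact: le_trans (m0 x) (mM x).
apply: le_trans (double_le (m0 x) M0).
apply: lime_le.
  by apply: ereal_nondecreasing_is_cvgn; exact: second_nondecreasing.
apply: nearW => n.
have mMn x' : mean g z D mu n x' <= M by exact: le_trans (mean_m n x') (mM x').
apply: (le_trans (second_le g_measurable g_ge0 mDelta mMn x)).
by apply: lee_wpmul2l; [rewrite mule_ge0|exact: mean_m].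
Qed.

End bounds.

Theorem theorem4p8 (R : realType) (d : measure_display)
    (S : measurableCompleteMetricType d R)
    (S_borel : borel_sigma_algebra S)
    (S_separable : separable S)
    (S_locally_compact : locally_compact [set: S])
    (mu : {measure set S -> \bar R}) (mu_radon : radon mu)
    (g : S -> S -> R)
    (g_ge0 : forall z z', 0 <= g z z')
    (g_measurable : measurable_fun [set: S * S] (fun p : S * S => g p.1 p.2))
    (g_density : forall z, (\int[mu]_z' (g z z')%:E = 1)%E)
    (Delta : S)
    (mu_Delta : mu [set Delta] = 1%E)
    (g_Delta : forall z', g Delta z' = \1_[set Delta] z')
    (dO : measure_display) (Omega : measurableType dO) (Q : probability Omega R)
    (eta : Omega -> {measure set (S * measurableTypeR R) -> \bar R})
    (eta_ppp : poisson_point_process mu Q eta) :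
  (forall z z0 : S,
    (\int[Q]_w (slt_at_hitting g Delta (atoms (eta w)) z0 z ^+ 2) <=
     4%:E * (\int[Q]_w slt_at_hitting g Delta (atoms (eta w)) z0 z) *
     ereal_sup [set \int[Q]_w slt_at_hitting g Delta (atoms (eta w)) z0' z
               | z0' in [set: S]])%E)
  /\
  (forall (n : nat) (z z0 : S),
    (\int[Q]_w ((soft_local_time g (atoms (eta w)) z0 n z)%:E ^+ 2) <=
     4%:E * (\int[Q]_w (soft_local_time g (atoms (eta w)) z0 n z)%:E) *
     ereal_sup [set \int[Q]_w (soft_local_time g (atoms (eta w)) z0' n z)%:E
               | z0' in [set: S]])%E).
Proof.
have [K [cK mK ndK covK]] := compact_exhaustion S_borel S_separable S_locally_compact.
have [mu' mu'E] := radon_sigma_finite mu_radon cK mK covK.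
have mu'F : mu' = mu :> (set S -> \bar R) by rewrite -mu'E.
have muK j : (mu' (K j) < +oo)%E by rewrite mu'F; exact: mu_radon.1.
have mu'_density z : (\int[mu']_z' (g z z')%:E = 1)%E by rewrite mu'F.
have eta_ppp' : poisson_point_process mu' Q eta by rewrite mu'E.
pose N := configuration_of cK mK ndK covK eta_ppp'.
have pN : poisson_law Q (ground_measure mu') N.
  exact: (poisson_configuration cK mK ndK covK muK eta_ppp').
have N_atomic w (A : set (S * measurableTypeR R)) : measurable A -> N w A != 0%E ->
    exists2 p, atoms (N w) p & A p.
  have [eta_pm _ _ _ _] := eta_ppp; have [[L [p [_ etaE]]] _] := eta_pm w.
  exact: (point_measure_atomic etaE (measurable_singleton_pair S_borel)).
split => [z z0|n z z0].
  exact: (hitting_time_bound g_measurable g_ge0 mu'_density pN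
    (measurable_singleton_pair S_borel) N_atomic).
exact: (fixed_time_bound g_measurable g_ge0 mu'_density pN
    (measurable_singleton_pair S_borel) N_atomic).
Qed.
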